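(* Let $G$ be a countably infinite, finitely generated amenable group. For every $r\in\mathbb{N}$ and $\varepsilon>0$ there exist an $(r,\varepsilon)$-invariant tile set $\mathcal{T}$ and a shift $Q\subset\mathcal{T}^G$ (a $\mathcal{T}$-quasi-tiling shift) with the following properties: (1) the error density of $Q$ is at most $\varepsilon$; (2) $h(Q)<\varepsilon$; (3) $Q$ is strongly irreducible.
   Context: Fix a left-invariant word metric $d$ on $G$, and let $B_r=\{g\in G: d(e,g)\le r\}$. For finite nonempty $F\subset G$ let $\partial_rF=\{g\in G: gB_r\cap F\ne\emptyset \text{ and } gB_r\cap(G\setminus F)\neq\emptyset\}$ and $\rho_r(F)=|\partial_rF|/|F|$; $F$ is $(r,\varepsilon)$-invariant if $\rho_r(F)\le\varepsilon$. A sequence $(F_n)$ of finite nonempty subsets of $G$ is Følner if $\lim_n\rho_r(F_n)=0$ for every $r\in\mathbb{N}$. For a finite set $A$, $A^G$ carries the product topology and $G$ acts on it by $[gx](h)=x(g^{-1}h)$. A shift is a nonempty closed $G$-invariant subset $X\subseteq A^G$. For finite $K\subset G$, $x_K$ is the restriction of $x$ to $K$ and $X_K=\{x_K : x\in X\}$. The entropy of $X$ is $h(X)=\lim_{n}\frac{1}{|F_n|}\log|X_{F_n}|$ for any Følner sequence $(F_n)$ (the limit exists and does not depend on the sequence). $X$ is strongly irreducible if there is $r\in\mathbb{N}$ such that for all finite $K,H\subset G$ with $d(k,h)>r$ for all $k\in K$, $h\in H$, and all $x,y\in X$, there is $z\in X$ with $z_K=x_K$ and $z_H=y_H$. A tile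 set $\mathcal{T}=(T_1,\dots,T_n)$ is a finite collection of finite subsets of $G$, each containing the identity; it is $(r,\varepsilon)$-invariant if every $T_i$ is. A (disjoint) $\mathcal{T}$-quasi-tiling is a map $T\colon G\to\mathcal{T}\cup\{\emptyset\}$ such that $gT(g)\cap hT(h)=\emptyset$ for all $g\ne h$ in $G$. The set of these is denoted $\mathcal{T}^G$; it is a shift over the alphabet $\mathcal{T}\cup\{\emptyset\}$. An element of $G$ is a $T$-error if it lies in no set $gT(g)$, $g\in G$; $e(T,F)$ is the number of $T$-errors in $F$. A $\mathcal{T}$-quasi-tiling shift is a shift $Q\subseteq\mathcal{T}^G$; its error density is at most $\varepsilon$ if there is $\delta>0$ such that $e(T,F)\le\varepsilon|F|$ for all $T\in Q$ and all finite $(1,\delta)$-invariant $F\subset G$. *)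

(* Defs.v *)
From HB Require Import structures.
From mathcomp Require Import all_boot all_order all_algebra finmap.
From mathcomp Require Import all_classical all_reals all_analysis.

Set Implicit Arguments.
Unset Strict Implicit.
Unset Printing Implicit Defensive.

Import Order.TTheory GRing.Theory Num.Theory.
Import numFieldNormedType.Exports.

Local Open Scope classical_set_scope.
Local Open Scope ring_scope.

Section Group.
Context {G : groupType}.
Implicit Types (F K : {fset G}) (g h : G) (r n : nat).

Definition is_word (S : {fset G}) (w : seq G) : bool :=
  all (fun s => (s \in S) || (s^-1%g \in S)) w.

Definition spells (S : {fset G}) (g : G) (n : nat) : Prop :=
  exists w : seq G, [/\ is_word S w, size w = n & (\prod_(s <- w) s)%g = g].

Definition generates (S : {fset G}) : Prop := forall g, exists n, spells S g n.

(* A group is finitely generated exactly when it has a [genset]. *)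
Record genset : Type := Genset {
  generators :> {fset G};
  genset_generates : generates generators }.

Implicit Types S : genset.

Lemma ex_spells S g : exists n, `[< spells S g n >].
Proof. by have [n gn] := genset_generates S g; exists n; apply/asboolP. Qed.

Definition word_length S g : nat := ex_minn (ex_spells S g).

Definition word_dist S g h : nat := word_length S (g^-1 * h)%g.

Definition ball S r : set G := [set g | (word_dist S 1%g g <= r)%N].

Definition translate g F : {fset G} := [fset (g * x)%g | x in F]%fset.

Definition boundary S r F : set G :=
  [set g | (exists2 b, ball S r b & (g * b)%g \in F) /\
           (exists2 b, ball S r b & (g * b)%g \notin F)].

Lemma finite_ball S r : finite_set (ball S r).
Proof.
pose L : {fset G} := (S `|` [fset s^-1%g | s in (S : {fset G})])%fset.
pose W n : set G := [set g | spells S g n].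
have finW n : finite_set (W n).
  elim: n => [|n IHn].
    apply: (@sub_finite_set _ _ [set 1%g]); last exact: finite_set1.
    by move=> g [w [_ /size0nil-> <-]]; rewrite big_nil.
  apply: (@sub_finite_set _ _
    ((fun p : G * G => (p.1 * p.2)%g) @` ([set` L] `*` W n))); last first.
    by apply/finite_image/finite_setX => //; exact: finite_fset.
  move=> g [[|s w] [//= /andP[sS wS] [sz_w] <-]].
  exists (s, (\prod_(t <- w) t)%g); rewrite /= ?big_cons//; split => /=.
    rewrite !inE; case/orP: sS => [->//|sVS]; apply/orP; right.
    by apply/imfsetP; exists s^-1%g => //; rewrite invgK.
  by exists w.
apply: (@sub_finite_set _ _ (\bigcup_(n in `I_r.+1) W n)); last first.
  by apply: bigcup_finite => [|n _]; [exact: finite_II|exact: finW].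
move=> g; rewrite /ball /= /word_dist invg1 mul1g /word_length.
by case: ex_minnP => n /asboolP gn _ ler; exists n.
Qed.

(* Hence [fset_set (boundary S r F)], used below, is never the junk value. *)
Lemma finite_boundary S r F : finite_set (boundary S r F).
Proof.
apply: (@sub_finite_set _ _
  ((fun p : G * G => (p.1 * p.2^-1)%g) @` ([set` F] `*` ball S r))).
  by move=> g [[b rb gbF] _]; exists ((g * b)%g, b); rewrite //= mulgK.
apply/finite_image/finite_setX; first exact: finite_fset.
exact: finite_ball.
Qed.

Section Invariance.
Context (R : realType).

Definition rho S r F : R :=
  #|` fset_set (boundary S r F)|%:R / #|` F|%:R.

Definition invariant S r (eps : R) F : Prop :=
  F != fset0 /\ rho S r F <= eps.

Definition folner S (F : nat -> {fset G}) : Prop :=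
  (forall n, F n != fset0) /\
  forall r, (fun n => rho S r (F n)) @ \oo --> (0 : R).

End Invariance.

Definition amenable (R : realType) S : Prop :=
  exists F : nat -> {fset G}, folner R S F.

Section Shifts.
Context {A : finType}.
Implicit Types (x : G -> A) (X : set (G -> A)).

Definition translation g x : G -> A := fun h => x (g^-1 * h)%g.

Definition is_shift X : Prop :=
  [/\ X !=set0,
      closed (X : set {ptws G -> discrete_topology A}) &
      forall g x, X x -> X (translation g x)].

Definition restrict_to K x : {ffun K -> A} := [ffun k => x (val k)].

Definition patterns X K : set {ffun K -> A} := restrict_to K @` X.
Arguments patterns : clear implicits.

(* [has_entropy X h] says that h(X) exists and equals h: the limit exists and
   equals h along every Folner sequence. *)
Definition has_entropy (R : realType) S X (h : R) : Prop :=
  forall F : nat -> {fset G}, folner R S F ->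
    (fun n => ln #|` fset_set (patterns X (F n))|%:R / #|` F n|%:R)
      @ \oo --> h.

Definition strongly_irreducible S X : Prop :=
  exists r, forall K H : {fset G},
    (forall k h, k \in K -> h \in H -> (r < word_dist S k h)%N) ->
    forall x y, X x -> X y ->
    exists z, [/\ X z, restrict_to K z = restrict_to K x &
                  restrict_to H z = restrict_to H y].

End Shifts.

Definition tile_set (T : {fset {fset G}}) : Prop :=
  forall F, F \in T -> 1%g \in F.

Definition tile_set_invariant (R : realType) S r (eps : R)
    (T : {fset {fset G}}) : Prop :=
  forall F, F \in T -> invariant S r eps F.

Definition tiles (T : {fset {fset G}}) : {fset {fset G}} := (fset0 |` T)%fset.

(* The subset g t(g) of G, where t : G -> T \cup {emptyset}. *)
Definition placed (T : {fset {fset G}}) (t : G -> tiles T) g : {fset G} :=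
  translate g (val (t g)).

Definition quasi_tilings (T : {fset {fset G}}) : set (G -> tiles T) :=
  [set t | forall g h, g != h -> (placed t g `&` placed t h)%fset = fset0].

Definition errors (T : {fset {fset G}}) (t : G -> tiles T) F : {fset G} :=
  [fset g in F | ~~ `[< exists h, g \in placed t h >]]%fset.

Definition error_density_le (R : realType) S (T : {fset {fset G}})
    (Q : set (G -> tiles T)) (eps : R) : Prop :=
  exists2 delta : R, 0 < delta &
    forall (t : G -> tiles T) F, Q t -> invariant S 1 delta F ->
      #|` errors t F|%:R <= eps * #|` F|%:R.

End Group.

Arguments genset : clear implicits.
Arguments patterns {G A} X K.
Arguments quasi_tilings {G} T.

(* Main.v *)
(** Tiles are large subsets of the members F of a finite list of Følner sets,
    arranged in levels. A valid quasi-tiling is saturated at each level: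
    relative to the tiles of its own and all higher levels, no tile of that
    level can be added or enlarged. Saturation is a local condition, and any
    disjoint partial configuration extends, level by level from the top and by
    Zorn, to a saturated one without disturbing regions where it is already
    saturated; this gives non-emptiness and strong irreducibility.

    Saturation also forces a level set F placed at an uncovered point g to
    meet the covered region in more than d|F| points. Counting pairs (g, f)
    with g uncovered and gf covered shows that each further level shrinks the
    uncovered part of an invariant set K by a factor 1/(1 + d), up to a small
    multiple of |K|, because the region covered by the higher levels is a
    union of almost invariant sets and so is entered by few pairs.

    Shearer's inequality, applied to the cover of a set by the translates of
    K, shows that the entropy exists and is the infimum of log |X_K| / |K|
    over all finite K. It is then small because a shape of F is obtained by
    deleting at most d|F| points, so the shapes of F number at most exp(c|F|)
    with c small, while tiles rooted in an invariant K have total size at most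
    2|K|. *)
Require Import Defs.
From HB Require Import structures.
From mathcomp Require Import all_boot all_order all_algebra finmap.
From mathcomp Require Import all_classical all_reals all_analysis.
From mathcomp Require Import ring lra.

Set Implicit Arguments.
Unset Strict Implicit.
Unset Printing Implicit Defensive.

Import Order.TTheory GRing.Theory Num.Theory.
Local Open Scope classical_set_scope.
Local Open Scope ring_scope.

(** * Saturated configurations *)

Section Configurations.
Context {R : realType} {G : groupType}.
Implicit Types (A E F : {fset G}) (Fs : seq {fset G}) (t x y z : G -> {fset G}) (d : R).

(** Containing the identity makes a shape a legal tile, and makes a placed tile cover its own
    root. *)
Definition shapes d F : {fset {fset G}} :=
  [fset A in fpowerset F | (1%g \in A) && ((1 - d) * #|` F|%:R <= #|` A|%:R)]%fset.

Lemma shapesP d F A :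
  reflect [/\ (A `<=` F)%fset, 1%g \in A & (1 - d) * #|` F|%:R <= #|` A|%:R]
          (A \in shapes d F).
Proof.
rewrite !inE fpowersetE.
by apply: (iffP and3P).
Qed.

Lemma shape_neq0 d F A : A \in shapes d F -> A != fset0.
Proof. by case/shapesP => _ A1 _; apply/fset0Pn; exists 1%g. Qed.

Lemma shape_card d F A : A \in shapes d F -> (#|` A| <= #|` F|)%N.
Proof. by case/shapesP => /fsubset_leq_card. Qed.

Lemma shape_sup d F A B : A \in shapes d F -> (A `<=` B)%fset ->
  (B `<=` F)%fset -> B \in shapes d F.
Proof.
case/shapesP => _ A1 szA AB BF; apply/shapesP; split => //.
  exact: (fsubsetP AB).
by rewrite (le_trans szA)// ler_nat fsubset_leq_card.
Qed.

(** Membership of $g^{-1}u$ in [t g] says that $u$ lies in the placed tile. Tiles are plain finite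
    sets, not tied to a tile set, so that truncated and partial configurations keep one type. *)
Definition disjoint_tiles t := forall g h u,
  (g^-1 * u)%g \in t g -> (h^-1 * u)%g \in t h -> g = h.

Definition trunc (n : nat) t : G -> {fset G} :=
  fun g => if (#|` t g| <= n)%N then fset0 else t g.

Definition blocked t g A := exists h u,
  [/\ h != g, (g^-1 * u)%g \in A & (h^-1 * u)%g \in t h].

(** An empty [t g] is the case of adding a tile at [g], a nonempty one that of enlarging it. A tile
    with more points than [F] imposes nothing at its own root, since it fits into no shape of
    [F]. *)
Definition saturated d F t := forall g A, A \in shapes d F ->
  (t g `<=` A)%fset -> t g != A -> blocked t g A.

(* The lowest level, with the smallest tiles, is the head of [Fs]; truncating
   at [#|` F|] discards exactly its tiles. *)
Fixpoint valid d Fs t : Prop :=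
  if Fs is F :: Fs' then
    [/\ valid d Fs' (trunc #|` F| t), disjoint_tiles t,
        forall g, (#|` t g| <= #|` F|)%N -> t g = fset0 \/ t g \in shapes d F &
        saturated d F t]
  else forall g, t g = fset0.

Lemma trunc_sub n t g : (trunc n t g `<=` t g)%fset.
Proof. by rewrite /trunc; case: ifP => // _; exact: fsub0set. Qed.

Lemma valid_tile d Fs t g : valid d Fs t ->
  t g = fset0 \/ exists2 F, F \in Fs & t g \in shapes d F.
Proof.
elim: Fs t => [|F Fs IH] t /=; first by move=> ->; left.
case=> vt _ tF _; case: (leqP #|` t g| #|` F|) => [/tF[]|]; first by left.
  by right; exists F; first exact: mem_head.
move=> big; have := IH _ vt; rewrite /trunc leqNgt big /= => -[]; first by left.
by move=> [F' F'Fs tF']; right; exists F' => //; rewrite inE F'Fs orbT.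
Qed.

Lemma valid_disjoint d Fs t : valid d Fs t -> disjoint_tiles t.
Proof. by case: Fs => [t0 g h u|F Fs []//]; rewrite t0 inE. Qed.

(** Every shape of [F'] then has more points than [F], so the level of a tile can be read off its
    size. *)
Definition size_separated d F F' : Prop :=
  #|` F|%:R < (1 - d) * #|` F'|%:R.

Lemma size_separated_lt d F F' A : size_separated d F F' ->
  A \in shapes d F' -> (#|` F| < #|` A|)%N.
Proof. by move=> s /shapesP[_ _ /(lt_le_trans s)]; rewrite ltr_nat. Qed.

Lemma trunc_valid d F Fs t :
  (forall F', F' \in Fs -> size_separated d F F') ->
  valid d Fs t -> trunc #|` F| t = t.
Proof.
move=> sep vt; apply/funext => g; rewrite /trunc.
have [t0|[F' F'Fs tF']] := valid_tile g vt.
  by rewrite t0; case: leqP.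
by rewrite leqNgt (size_separated_lt (sep _ F'Fs) tF').
Qed.

Lemma chain_point (C : set (G -> {fset G})) n g :
  C !=set0 ->
  (forall z, C z -> #|` z g| <= n)%N ->
  exists2 z, C z & forall z', C z' -> (#|` z' g| <= #|` z g|)%N.
Proof.
move=> [z0 Cz0] bnd.
pose P k := `[< exists2 z, C z & #|` z g| = k >].
have exP : exists k, P k by exists #|` z0 g|; apply/asboolP; exists z0.
have bP k : P k -> (k <= n)%N.
  by move=> /asboolP[z Cz <-]; exact: bnd.
have [k /asboolP[z Cz zk] max] := ex_maxnP exP bP.
by exists z => // z' Cz'; rewrite zk; apply: max; apply/asboolP; exists z'.
Qed.

(** Zorn's lemma for disjoint configurations above [p] whose changed tiles are shapes of [F],
    ordered by inclusion at every point. A maximal one is saturated, because an unblocked larger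
    shape could replace a tile. *)
Lemma exists_saturated d F p : disjoint_tiles p -> exists z,
  [/\ disjoint_tiles z, saturated d F z, forall g, (p g `<=` z g)%fset &
      forall g, z g = p g \/ z g \in shapes d F].
Proof.
move=> pdis.
pose P z := [/\ disjoint_tiles z, forall g, (p g `<=` z g)%fset &
      forall g, z g = p g \/ z g \in shapes d F].
pose T := {z : G -> {fset G} | P z}.
pose le : rel T := fun a b => `[< forall g, (sval a g `<=` sval b g)%fset >].
have Pp : P p by split => //; left.
have lexx (z : T) : le z z by apply/asboolP => g; exact: fsubset_refl.
have letr (z1 z2 z3 : T) : le z1 z2 -> le z2 z3 -> le z1 z3.
  move=> /asboolP a /asboolP b; apply/asboolP => g; exact: fsubset_trans (b g).
have lean (z1 z2 : T) : le z1 z2 -> le z2 z1 -> z1 = z2.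
  case: z1 z2 => [z1 P1] [z2 P2] /asboolP /= a /asboolP /= b.
  apply: eq_exist; apply/funext => g; apply/eqP.
  by rewrite eqEfsubset a b.
have chain (C : set T) : total_on C (fun a b => le a b) ->
    exists b, forall s, C s -> le s b.
  move=> Ctot; have [->|/set0P[c0 Cc0]] := eqVneq C set0.
    by exists (exist _ p Pp) => s.
  (* The upper bound of a chain is taken point by point: sizes at [g] are bounded, so some member
     has the largest tile there. Disjointness at two points is inherited from the larger of two
     members. *)
  have ex g : exists s : T, C s /\
      forall s', C s' -> (#|` sval s' g| <= #|` sval s g|)%N.
    have [||_ [z Cz <-] zmax] := @chain_point [set sval z | z in C] (maxn #|` p g| #|` F|) g.
    - by exists (sval c0); exists c0.
    - move=> _ [[z Pz] Cz <-] /=; have [_ _ zp] := Pz; rewrite leq_max.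
      by case: (zp g) => [->|/shape_card ->]; rewrite ?leqnn ?orbT.
    by exists z; split => // z' Cz'; apply: zmax; exists z'.
  have [f Hf] := boolp.choice ex.
  have fC g : C (f g) by case: (Hf g).
  have fsub g (z : T) : C z -> (sval z g `<=` sval (f g) g)%fset.
    move=> Cz; have [/asboolP ->//|/asboolP zf] := Ctot _ _ Cz (fC g).
    suff -> : sval z g = sval (f g) g by exact: fsubset_refl.
    apply/eqP; rewrite eq_sym eqEfcard zf /=; apply: (Hf g).2 => //.
  have Pf : P (fun g => sval (f g) g).
    split.
    - move=> g h u gu hu; have [/asboolP gh|/asboolP hg] := Ctot _ _ (fC g) (fC h).
        have [fdis _ _] := svalP (f h); apply: fdis hu.
        exact: (fsubsetP (gh g)).
      have [fdis _ _] := svalP (f g); apply: fdis gu _.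
      exact: (fsubsetP (hg h)).
    - by move=> g; have [] := svalP (f g).
    - by move=> g; have [] := svalP (f g).
  exists (exist _ _ Pf) => s Cs; apply/asboolP => g /=; exact: fsub.
have [[z [zdis pz zsh]] zmax] := Zorn lexx letr lean chain.
exists z; split => // g A Ash zA zneA; apply: contrapT => nb.
pose z' h := if h == g then A else z h.
have Pz' : P z'.
  split.
  - move=> a b u; rewrite /z'; case: eqP => [->|/eqP ag]; case: eqP => [->//|/eqP bg].
    + by move=> uA ub; case: nb; exists b, u.
    + by move=> ua uA; case: nb; exists a, u.
    + exact: zdis.
  - move=> h; rewrite /z'; case: eqP => [->|//].
    exact: fsubset_trans (pz g) zA.
  - by move=> h; rewrite /z'; case: eqP => [_|_]; [right|exact: zsh].
suff: z' g = z g by rewrite /z' eqxx => e; rewrite e eqxx in zneA.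
have := zmax (exist _ z' Pz').
suff: le (exist _ z (And3 zdis pz zsh)) (exist _ z' Pz').
  by move=> /[swap] /[apply] /(congr1 (fun s : T => sval s g)).
apply/asboolP => h /=; rewrite /z'.
by case: eqP => [->|].
Qed.

(** Saturating only introduces shapes of [F], of size at most $|F|$, and a changed tile was no
    larger before. Truncation is therefore unaffected and the higher levels stay valid. *)
Lemma valid_extend d F Fs p :
  (forall F', F' \in Fs -> size_separated d F F') ->
  disjoint_tiles p -> valid d Fs (trunc #|` F| p) ->
  (forall g, (#|` p g| <= #|` F|)%N -> p g = fset0 \/ p g \in shapes d F) ->
  exists z, [/\ valid d (F :: Fs) z, forall g, (p g `<=` z g)%fset &
      forall g, z g = p g \/ z g \in shapes d F].
Proof.
move=> sep pdis vp psh; have [z [zdis zsat pz zsh]] := exists_saturated d F pdis.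
exists z; split => //=; split => //; last first.
  by move=> g; case: (zsh g) => [->|]; [exact: psh|right].
suff -> : trunc #|` F| z = trunc #|` F| p by [].
apply/funext => g; rewrite /trunc; case: (zsh g) => [-> //|/shape_card le].
by rewrite le (leq_trans (fsubset_leq_card (pz g)) le).
Qed.

Fixpoint levels_separated d Fs : Prop :=
  if Fs is F :: Fs' then
    (forall F', F' \in Fs' -> size_separated d F F') /\ levels_separated d Fs'
  else True.

Lemma valid_exists d Fs : levels_separated d Fs -> exists t, valid d Fs t.
Proof.
elim: Fs => [_|F Fs IH [sep /IH[t vt]]]; first by exists (fun=> fset0).
have e := trunc_valid sep vt.
have [|||z [vz _ _]] := @valid_extend d F Fs t sep.
- exact: valid_disjoint vt.
- by rewrite e.
- by move=> g tF; left; rewrite -e /trunc tF.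
by exists z.
Qed.

Lemma valid_translation d Fs t g : valid d Fs t ->
  valid d Fs (fun h => t (g^-1 * h)%g).
Proof.
elim: Fs t => [t t0 h|F Fs IH t [vt tdis tsh tsat]]; first exact: t0.
split.
- exact: (IH _ vt).
- move=> a b u au bu; apply: (mulgI g^-1%g); apply: (tdis _ _ (g^-1 * u)%g).
    by rewrite invgM invgK -mulgA mulVKg.
  by rewrite invgM invgK -mulgA mulVKg.
- by move=> h; exact: tsh.
- move=> h A Ash tA tneA; have [k [u [kh uA uk]]] := tsat _ A Ash tA tneA.
  exists (g * k)%g, (g * u)%g; split.
  + by apply: contraNneq kh => <-; rewrite mulKg.
  + by move: uA; rewrite invgM invgK -mulgA.
  + by rewrite invgM -mulgA !mulKg.
Qed.

End Configurations.

(** * Locality and gluing *)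

Section LocalRules.
Context {R : realType} {G : groupType} (E : {fset G}).
Implicit Types (A F : {fset G}) (Fs : seq {fset G}) (t x y z : G -> {fset G}) (d : R).
Implicit Types (P Q : set G).

(** That is, $gE$ and $hE$ meet, as $ga = hb$. When all tiles lie in [E], only tiles rooted at near
    points can intersect. *)
Definition near g h : Prop := exists a b, [/\ a \in E, b \in E & (g^-1 * h = a * b^-1)%g].

Definition neighborhood P : set G := [set h | exists2 g, P g & near g h].

Lemma near_meet A B g h u : (A `<=` E)%fset -> (B `<=` E)%fset ->
  (g^-1 * u)%g \in A -> (h^-1 * u)%g \in B -> near g h.
Proof.
move=> /fsubsetP AE /fsubsetP BE /AE gu /BE hu.
exists (g^-1 * u)%g, (h^-1 * u)%g; split => //.
by rewrite invgM invgK mulgA mulgK.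
Qed.

Lemma tile_sub d Fs t g : (forall F, F \in Fs -> (F `<=` E)%fset) ->
  valid d Fs t -> (t g `<=` E)%fset.
Proof.
move=> FsE vt; have [->|[F /FsE FE]] := valid_tile g vt; first exact: fsub0set.
by move=> /shapesP[tF _ _]; exact: fsubset_trans FE.
Qed.

(** Each condition involves only tiles rooted near one or two given points, hence is tested on a
    finite window. *)
Lemma valid_closed d Fs t : (forall F, F \in Fs -> (F `<=` E)%fset) ->
  (forall W : {fset G}, exists2 s, valid d Fs s & {in W, s =1 t}) ->
  valid d Fs t.
Proof.
elim: Fs t => [|F Fs IH] t FsE tcl.
  move=> g; have [s s0 st] := tcl [fset g]%fset.
  by rewrite -st ?s0// inE.
split.
- apply: IH => [F' F'Fs|W]; first by apply: FsE; rewrite inE F'Fs orbT.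
  have [s [vs _ _ _] st] := tcl W; exists (trunc #|` F| s) => // g gW.
  by rewrite /trunc st.
- move=> g h u gu hu; have [s [_ sdis _ _] st] := tcl [fset g; h]%fset.
  by apply: (sdis g h u); rewrite st// !inE eqxx ?orbT.
- move=> g; have [s [_ _ ssh _] st] := tcl [fset g]%fset.
  by rewrite -(st g) ?in_fset1//; exact: ssh.
- move=> g A Ash tA tneA.
  (* This window contains every root from which a tile could block [A] at [g]. *)
  pose W := (g |` [fset (g * (a * b^-1))%g | a in E, b in E])%fset.
  have [s vs st] := tcl W.
  have sg : s g = t g by apply: st; rewrite !inE eqxx.
  rewrite -sg in tA tneA.
  have [_ _ _ ssat] := vs.
  have [h [u [hg uA uh]]] := ssat g A Ash tA tneA.
  have AE : (A `<=` E)%fset.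
    by case/shapesP: (Ash) => AF _ _; rewrite (fsubset_trans AF)// FsE// mem_head.
  have [a [b [aE bE gh]]] := near_meet AE (tile_sub h FsE vs) uA uh.
  exists h, u; split => //; rewrite -st// !inE; apply/orP; right.
  by apply/imfset2P; exists a => //; exists b => //; rewrite -gh mulVKg.
Qed.

Hypothesis E1 : 1%g \in E.

Lemma near_refl g : near g g.
Proof. by exists 1%g, 1%g; rewrite mulVg mulgV. Qed.

Lemma sub_neighborhood P : P `<=` neighborhood P.
Proof. by move=> g Pg; exists g => //; exact: near_refl. Qed.

Lemma iter_neighborhood P n : P `<=` iter n neighborhood P.
Proof. by elim: n => //= n IH g /IH; exact: sub_neighborhood. Qed.

(** Induction from the top level. The higher levels are glued so as to agree with [x] and [y] on
    double neighborhoods of [P] and [Q], the lowest level is copied on single neighborhoods, and the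
    result is saturated. Each level thus costs two neighborhoods. *)
Lemma valid_glue d Fs P Q : (forall F, F \in Fs -> (F `<=` E)%fset) ->
  levels_separated d Fs ->
  (forall g, iter (size Fs).*2 neighborhood P g ->
     ~ iter (size Fs).*2 neighborhood Q g) ->
  forall x y, valid d Fs x -> valid d Fs y ->
  exists z, [/\ valid d Fs z, forall g, P g -> z g = x g &
    forall g, Q g -> z g = y g].
Proof.
elim: Fs P Q => [|F Fs IH] P Q FsE; first by move=> _ _ x y vx vy; exists x; 
  split => // g _; rewrite vx vy.
move=> [sep lsep]; rewrite [size (F :: Fs)]/= doubleS !iterSr.
set PP := neighborhood (neighborhood P); set QQ := neighborhood (neighborhood Q).
move=> far x y vx vy.
have FE : (F `<=` E)%fset by apply: FsE; rewrite mem_head.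
have FsE' F' : F' \in Fs -> (F' `<=` E)%fset.
  by move=> F'Fs; apply: FsE; rewrite inE F'Fs orbT.
have PQ g : PP g -> ~ QQ g.
  by move=> Pg Qg; apply: (far g); exact: iter_neighborhood.
have [vx' xdis xsh xsat] := vx; have [vy' ydis ysh ysat] := vy.
have [z' [vz' zx zy]] := IH PP QQ FsE' lsep far _ _ vx' vy'.
have trz' := trunc_valid sep vz'.
pose p g := if `[< neighborhood P g >] then x g else
            if `[< neighborhood Q g >] then y g else z' g.
have px g : neighborhood P g -> p g = x g by rewrite /p => /asboolP ->.
have py g : neighborhood Q g -> p g = y g.
  move=> Qg; rewrite /p asboolF ?asboolT//.
  by move=> Pg; apply: (PQ g); exact: sub_neighborhood.
have pz g : ~ neighborhood P g -> ~ neighborhood Q g -> p g = z' g.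
  by move=> /asboolPn/negbTE nP /asboolPn/negbTE nQ; rewrite /p nP nQ.
have xE g := tile_sub g FsE vx.
have yE g := tile_sub g FsE vy.
have zE g := tile_sub g FsE' vz'.
(* A tile of [z'] meeting a tile rooted in the neighborhood of [S] is rooted in the double
   neighborhood, where [z'] is the truncation of [w]; so both tiles come from [w]. *)
have pdis_near (w : G -> {fset G}) (S : set G) g h u : disjoint_tiles w ->
    (forall a, neighborhood (neighborhood S) a -> z' a = trunc #|` F| w a) ->
    (forall a, w a `<=` E)%fset -> neighborhood S g ->
    (g^-1 * u)%g \in w g -> (h^-1 * u)%g \in z' h -> g = h.
  move=> wdis zw wE Sg gu hu; apply: (wdis g h u) => //.
  apply: (fsubsetP (trunc_sub #|` F| w h)); rewrite -zw//.
  by exists g => //; exact: near_meet gu hu.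
have pdis : disjoint_tiles p.
  move=> g h u.
  have [Pg|nPg] := pselect (neighborhood P g).
    rewrite (px _ Pg) => gu.
    have [Ph|nPh] := pselect (neighborhood P h); first by rewrite (px _ Ph); exact: xdis.
    have [Qh|nQh] := pselect (neighborhood Q h).
      rewrite (py _ Qh) => hu; case: (PQ h); last exact: sub_neighborhood.
      by exists g => //; exact: near_meet gu hu.
    by rewrite (pz _ nPh nQh); exact: (pdis_near x P).
  have [Ph|nPh] := pselect (neighborhood P h).
    have [Qg|nQg] := pselect (neighborhood Q g).
      rewrite (px _ Ph) (py _ Qg) => gu hu; case: (PQ g); last exact: sub_neighborhood.
      by exists h => //; exact: near_meet hu gu.
    rewrite (px _ Ph) (pz _ nPg nQg) => gu hu.
    by apply/esym; exact: (pdis_near x P h g u).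
  have [Qg|nQg] := pselect (neighborhood Q g);
    have [Qh|nQh] := pselect (neighborhood Q h).
  - by rewrite (py _ Qg) (py _ Qh); exact: ydis.
  - by rewrite (py _ Qg) (pz _ nPh nQh); exact: (pdis_near y Q).
  - rewrite (py _ Qh) (pz _ nPg nQg) => gu hu.
    by apply/esym; exact: (pdis_near y Q h g u).
  - by rewrite (pz _ nPg nQg) (pz _ nPh nQh); exact: valid_disjoint vz' _ _ _.
have trp : trunc #|` F| p = z'.
  apply/funext => g.
  have [Pg|nPg] := pselect (neighborhood P g).
    by rewrite zx ?/trunc ?px//; exact: sub_neighborhood.
  have [Qg|nQg] := pselect (neighborhood Q g).
    by rewrite zy ?/trunc ?py//; exact: sub_neighborhood.
  by rewrite -trz' /trunc pz.
have psh g : (#|` p g| <= #|` F|)%N -> p g = fset0 \/ p g \in shapes d F.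
  have [Pg|nPg] := pselect (neighborhood P g); first by rewrite px//; exact: xsh.
  have [Qg|nQg] := pselect (neighborhood Q g); first by rewrite py//; exact: ysh.
  by rewrite pz// => zF; left; rewrite -trz' /trunc zF.
have vp : valid d Fs (trunc #|` F| p) by rewrite trp.
have [z [vz subz zsh]] := valid_extend sep pdis vp psh.
(* A tile rooted in [S] cannot change: the enlargement would be blocked in [w] by a tile rooted in
   the neighborhood of [S], where [p] agrees with [w], and that tile survives in [z], against
   disjointness. *)
have keep (w : G -> {fset G}) (S : set G) g : (forall a, neighborhood S a -> p a = w a) ->
    saturated d F w -> (forall a, w a `<=` E)%fset -> S g -> z g = w g.
  move=> pw wsat wE Sg; have pg := pw _ (sub_neighborhood Sg).
  rewrite -pg; case: (zsh g) => // zF; apply: contrapT => zpg.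
  have [||h [u [hg gu hu]]] := wsat g (z g) zF.
  - by rewrite -pg; exact: subz.
  - by rewrite -pg; apply/eqP => e; rewrite e in zpg.
  have Sh : neighborhood S h.
    by exists g => //; apply: near_meet gu hu => //; exact: tile_sub vz.
  suff e : g = h by rewrite e eqxx in hg.
  apply: (valid_disjoint vz gu); apply: (fsubsetP (subz h)).
  by rewrite pw.
exists z; split => // g; first exact: keep.
by move=> Qg; exact: (keep y Q).
Qed.

End LocalRules.

(** * Counting uncovered points *)

Section Cardinality.
Context {T : choiceType}.
Implicit Types (A B : {fset T}).

Lemma card_fset_le_inj (U : choiceType) A (B : {fset U}) (f : T -> U) :
  injective f -> (forall x, x \in A -> f x \in B) -> (#|` A| <= #|` B|)%N.
Proof.
move=> f_inj fAB.
have <- : #|` [fset f x | x in A]%fset| = #|` A| by rewrite card_imfset.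
by apply: fsubset_leq_card; apply/fsubsetP => _ /imfsetP[x xA ->]; exact: fAB.
Qed.

Lemma card_fset_filter A (p : pred T) :
  #|` [fset x in A | p x]%fset| = (\sum_(x <- A) p x)%N.
Proof. by rewrite card_fset_sum1 big_fset/= big_mkcond. Qed.

Lemma card_bigfcup_le (I : Type) (s : seq I) (X : I -> {fset T}) :
  (#|` \bigcup_(i <- s) X i|%fset <= \sum_(i <- s) #|` X i|)%N.
Proof.
elim: s => [|i s IH]; first by rewrite !big_nil cardfs0.
by rewrite !big_cons (leq_trans (leq_card_fsetU _ _).1)// leq_add2l.
Qed.

Lemma card_fsubU_le A B C : (A `<=` B `|` C)%fset -> (#|` A| <= #|` B| + #|` C|)%N.
Proof. by move=> /fsubset_leq_card /leq_trans; apply; exact: (leq_card_fsetU _ _).1. Qed.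

End Cardinality.

Lemma double_count (T U : choiceType) (A : {fset T}) (B : {fset U}) (p : T -> U -> bool) :
  (\sum_(x <- A) #|` [fset y in B | p x y]%fset| =
   \sum_(y <- B) #|` [fset x in A | p x y]%fset|)%N.
Proof.
transitivity (\sum_(x <- A) \sum_(y <- B) p x y)%N.
  by apply: eq_bigr => x _; exact: (card_fset_filter B (p x)).
by rewrite exchange_big; apply: eq_bigr => y _; rewrite (card_fset_filter A (p^~ y)).
Qed.

(** * The uncovered part shrinks with each level *)

Section Covering.
Context {R : realType} {G : groupType}.
Implicit Types (A E F K P W : {fset G}) (Fs : seq {fset G}) (t : G -> {fset G}) (d eta : R).

(** A substitute for the boundary in one direction: subadditive in [c] and unchanged under left
    translation of [F]. *)
Definition moves F c : nat := #|` [fset x in F | (x * c)%g \notin F]%fset|.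

Definition stable P eta F : Prop :=
  forall c, c \in P -> (moves F c)%:R <= eta * #|` F|%:R.

Definition thicken F P : {fset G} := [fset (x * c)%g | x in F, c in P]%fset.

(** Outside $F$, the product set $FP$ has only the points of $Fc \setminus F$ with $c \in P$. *)
Lemma card_thicken F P eta : stable P eta F ->
  #|` thicken F P|%:R <= (1 + #|` P|%:R * eta) * #|` F|%:R.
Proof.
move=> st; pose X c := [fset (x * c)%g | x in [fset x in F | (x * c)%g \notin F]]%fset.
have sub : (thicken F P `<=` F `|` \bigcup_(c <- P) X c)%fset.
  apply/fsubsetP => _ /imfset2P[x /= xF [c cP ->]].
  rewrite inE; have [//|nF] := boolP ((x * c)%g \in F).
  apply/bigfcupP; exists c; rewrite ?cP//.
  by apply/imfsetP; exists x; rewrite // !inE /= xF nF.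
have := card_fsubU_le sub; rewrite -(ler_nat R) natrD => /le_trans; apply.
rewrite mulrDl mul1r lerD2l.
apply: (@le_trans _ _ (\sum_(c <- P) (moves F c)%:R)).
  rewrite -natr_sum ler_nat (leq_trans (card_bigfcup_le _ _))//.
  by apply: leq_sum => c _; exact: leq_imfset_card.
rewrite big_seq; apply: (@le_trans _ _ (\sum_(c <- P | c \in P) eta * #|` F|%:R)).
  by apply: ler_sum => c; exact: st.
rewrite -big_seq big_const_seq count_predT iter_addr_0.
by rewrite -mulrA mulr_natl.
Qed.

Lemma tiles_packing t (s : seq G) (W : {fset G}) : disjoint_tiles t -> uniq s ->
  (forall h a, h \in s -> a \in t h -> (h * a)%g \in W) ->
  (\sum_(h <- s) #|` t h| <= #|` W|)%N.
Proof.
move=> tdis; elim: s W => [|h s IH] W /=; first by rewrite big_nil.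
move=> /andP[hs us] HW; rewrite big_cons.
rewrite -(cardfsID (translate h (t h)) W) leq_add//.
  apply: (@card_fset_le_inj _ _ _ _ (fun a => (h * a)%g)); first exact: mulgI.
  move=> a ath; rewrite in_fsetI HW ?mem_head//=.
  by apply/imfsetP; exists a.
apply: IH => // k a ks ak; rewrite in_fsetD HW ?inE ?ks ?orbT// andbT.
apply/imfsetP => -[b /= bh kahb]; move/negP: hs; apply.
suff -> : h = k by [].
by apply: (tdis h k (k * a)%g); rewrite ?mulKg// kahb mulKg.
Qed.

Definition covered t u := exists h, (h^-1 * u)%g \in t h.

Definition uncovered t K : {fset G} := [fset u in K | ~~ `[< covered t u >]]%fset.

Lemma covered_trunc n t u : covered (trunc n t) u -> covered t u.
Proof. by move=> [h hu]; exists h; exact: (fsubsetP (trunc_sub n t h)). Qed.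

(* Saturation rules out enlarging a tile, so the part of a level set that its
   tile omits is covered by other tiles. *)
Lemma tile_covers d Fs t h : valid d Fs t -> t h != fset0 ->
  exists F, [/\ F \in Fs, t h \in shapes d F &
    forall u, (h^-1 * u)%g \in F -> covered t u].
Proof.
elim: Fs t => [|F Fs IH] t; first by move=> ->; rewrite eqxx.
move=> [vt tdis tsh tsat] th0.
have [le|big] := leqP #|` t h| #|` F|; last first.
  have trh : trunc #|` F| t h = t h by rewrite /trunc leqNgt big.
  have [|F' [F'Fs tF' cov]] := IH _ vt; first by rewrite trh.
  exists F'; split; first by rewrite inE F'Fs orbT.
    by rewrite -trh.
  by move=> u /cov; exact: covered_trunc.
have [th|thF] := tsh _ le; first by rewrite th eqxx in th0.
exists F; split => //; first exact: mem_head.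
move=> u uF; apply: contrapT => nu.
have nut : (h^-1 * u)%g \notin t h by apply/negP => ?; apply: nu; exists h.
have [|||k [v [kh]]] := tsat h ((h^-1 * u)%g |` t h)%fset.
- apply: (shape_sup thF); first exact: fsubsetU1.
  by apply/fsubsetP => a; rewrite !inE => /orP[/eqP ->//|];
    apply/fsubsetP; case/shapesP: thF.
- exact: fsubsetU1.
- by apply: contraNneq nut => ->; rewrite !inE eqxx.
rewrite !inE => /orP[/eqP/mulgI ->|vh] vk.
  by apply: nu; exists k.
by move/negP: kh; apply; rewrite (tdis k h v vk vh).
Qed.

(** Otherwise the uncovered part of $gF$ would be a shape, containing the identity since [g] is
    uncovered, and nothing would block it at [g], where no tile is rooted. *)
Lemma uncovered_neighbors d F Fs t g : 1%g \in F -> valid d (F :: Fs) t ->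
  ~ covered t g ->
  d * #|` F|%:R <= #|` [fset f in F | `[< covered t (g * f)%g >]]%fset|%:R.
Proof.
move=> F1 [vt tdis tsh tsat] ng; rewrite leNgt; apply/negP => few.
pose A := [fset f in F | ~~ `[< covered t (g * f)%g >]]%fset.
have cardA : (#|` [fset f in F | `[< covered t (g * f)%g >]]%fset| + #|` A| = #|` F|)%N.
  rewrite -(cardfsID [fset f in F | `[< covered t (g * f)%g >]]%fset F).
  congr (_ + _)%N; congr #|` _|; apply/fsetP => f; rewrite !inE /=;
    by case: (f \in F); rewrite ?andbT ?andbF.
have Ash : A \in shapes d F.
  apply/shapesP; split.
  - by apply/fsubsetP => f; rewrite !inE => /andP[].
  - by rewrite !inE F1 mulg1 /=; apply/asboolPn.
  - by move: few; rewrite -cardA natrD; lra.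
have tg0 : t g = fset0.
  have [->//|/(tile_covers (And4 vt tdis tsh tsat : valid d (F :: Fs) t))] := eqVneq (t g) fset0.
  move=> [F' [_ /shapesP[tF' t1 _] _]]; case: ng; exists g.
  by rewrite mulVg.
have [||h [u [hg]]] := tsat g A Ash.
- by rewrite tg0 fsub0set.
- by rewrite tg0 eq_sym (shape_neq0 Ash).
by rewrite !inE mulVKg => /andP[_ /asboolPn nu] uh; apply: nu; exists h.
Qed.

(** [F'] is the higher level. Inverses occur because the pairs to be counted lead from a covered
    point $gf$ back to the uncovered point $g = (gf)f^{-1}$. *)
Definition level_stable d eta F F' : Prop :=
  size_separated d F F' /\ forall c, c \in F -> (moves F' c^-1)%:R <= eta * #|` F'|%:R.

(** The set $EE^{-1}E$: a tile inside [E] that contains $gf$, with $g \in K$ and $f \in E$, is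
    placed within $KEE^{-1}E$. *)
Definition products E : {fset G} :=
  thicken (thicken E [fset a^-1%g | a in E]%fset) E.

Lemma mem_products E e a b : e \in E -> a \in E -> b \in E ->
  (e * a^-1 * b)%g \in products E.
Proof.
move=> eE aE bE; apply/imfset2P; exists (e * a^-1)%g; last by exists b.
by apply/imfset2P; exists e => //; exists a^-1%g => //; apply/imfsetP; exists a.
Qed.

Lemma sub_products E f : f \in E -> f \in products E.
Proof. by move=> fE; rewrite -[f](mulgVK f); exact: mem_products. Qed.

(** A tile at $h$ of level $F'$ accounts for at most $\eta|F'| \le 2\eta|t(h)|$ of these points. The
    tiles involved are disjoint inside $KEE^{-1}E$, so their sizes add up to at most $2|K|$. *)
Lemma tile_boundary_count d eta E K F Fs t f :
  d <= 1 / 2 -> 0 <= eta -> 1%g \in F -> f \in F ->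
  (forall F', F' \in F :: Fs -> (F' `<=` E)%fset) ->
  (forall F', F' \in Fs -> level_stable d eta F F') ->
  #|` thicken K (products E)|%:R <= 2 * #|` K|%:R :> R ->
  valid d Fs t ->
  #|` [fset g in K | `[< ~ covered t g /\ covered t (g * f)%g >]]%fset|%:R
    <= 4 * eta * #|` K|%:R.
Proof.
move=> d12 eta0 F1 fF FE lev KP vt.
have fE : f \in E by apply: (fsubsetP (FE F _)) fF; rewrite mem_head.
have tE h : (t h `<=` E)%fset.
  by apply: tile_sub vt => F' F'Fs; apply: FE; rewrite inE F'Fs orbT.
pose H := thicken K (thicken [fset f]%fset [fset a^-1%g | a in E]%fset).
pose X h := [fset g in K | `[< ~ covered t g /\ (h^-1 * (g * f))%g \in t h >]]%fset.
have sub : ([fset g in K | `[< ~ covered t g /\ covered t (g * f)%g >]]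
     `<=` fset0 `|` \bigcup_(h <- H) X h)%fset.
  apply/fsubsetP => g; rewrite !inE => /andP[gK /asboolP[ng [h hg]]] /=.
  apply/bigfcupP; exists h; last first.
    by rewrite !inE gK; apply/asboolP.
  rewrite andbT; apply/imfset2P; exists g => //.
  exists (f * (h^-1 * (g * f))^-1)%g.
    apply/imfset2P; exists f; first by rewrite inE.
    exists (h^-1 * (g * f))^-1%g => //; apply/imfsetP.
    by exists (h^-1 * (g * f))%g => //; exact: (fsubsetP (tE h)).
  by rewrite !invgM invgK !mulgA mulgK mulgV mul1g.
have XE h : #|` X h|%:R <= 2 * eta * #|` t h|%:R.
  have [t0|/(tile_covers vt)] := eqVneq (t h) fset0.
    rewrite (_ : X h = fset0) ?cardfs0 ?mulr_ge0//; apply/fsetP => g.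
    by rewrite !inE t0; apply/negbTE/negP => /andP[_ /asboolP[_]]; rewrite inE.
  move=> [F' [F'Fs /shapesP[tF' _ szt] cov]].
  have [_ /(_ f fF) mov] := lev _ F'Fs.
  (* All of $hF'$ is covered, not only the tile, so for an uncovered $g$ the point $h^{-1}g$ lies
     outside $F'$. *)
  have : (#|` X h| <= moves F' f^-1)%N.
    apply: (@card_fset_le_inj _ _ _ _ (fun g => (h^-1 * (g * f))%g)).
      by move=> a b /mulgI/mulIg.
    move=> g; rewrite !inE => /andP[_ /asboolP[ng gt]].
    rewrite (fsubsetP tF' _ gt)/= !mulgA mulgK.
    by apply/negP => /cov; rewrite /= => c; exact: ng.
  rewrite -(ler_nat R) => /le_trans; apply; apply: (le_trans mov).
  rewrite -mulrA mulrCA ler_wpM2l//; have : (0 : R) <= #|` F'|%:R by []; nra.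
have := card_fsubU_le sub; rewrite cardfs0 add0n => /leq_trans /(_ (card_bigfcup_le _ _)).
rewrite -(ler_nat R) => /le_trans; apply; rewrite natr_sum.
apply: (@le_trans _ _ (\sum_(h <- H) 2 * eta * #|` t h|%:R)).
  by apply: ler_sum => h _; exact: XE.
rewrite -mulr_sumr -natr_sum.
have : (\sum_(h <- H) #|` t h| <= #|` thicken K (products E)|)%N.
  apply: tiles_packing; [exact: valid_disjoint vt|exact: fset_uniq|].
  move=> h a /imfset2P[g /= gK [c /imfset2P[f' /=]]].
  rewrite inE => /eqP -> [e /imfsetP[b /= bE ->] ->] -> ah.
  rewrite -mulgA; apply/imfset2P; exists g => //; exists (f * b^-1 * a)%g => //.
  by apply: mem_products => //; exact: (fsubsetP (tE _)) ah.
rewrite -(ler_nat R) => pack.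
apply: (@le_trans _ _ (2 * eta * (2 * #|` K|%:R))); last by lra.
by rewrite ler_wpM2l ?mulr_ge0// (le_trans pack).
Qed.

(** Pairs $(g, f)$ with $g$ uncovered and $gf$ covered are counted twice. Each $g$ has at least
    $d|F|$ of them. For fixed $f$, either $gf$ is covered by higher levels ($4\eta|K|$ cases), or it
    leaves $K$ ($\eta|K|$ cases), or it is newly covered by level [F]. *)
Lemma uncovered_step d eta E K F Fs t :
  d <= 1 / 2 -> 0 <= eta -> 1%g \in F ->
  (forall F', F' \in F :: Fs -> (F' `<=` E)%fset) ->
  (forall F', F' \in Fs -> level_stable d eta F F') ->
  stable (products E) eta K -> #|` thicken K (products E)|%:R <= 2 * #|` K|%:R :> R ->
  valid d (F :: Fs) t ->
  (1 + d) * #|` uncovered t K|%:R <=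
  #|` uncovered (trunc #|` F| t) K|%:R + 5 * eta * #|` K|%:R.
Proof.
move=> d12 eta0 F1 FE lev Kst KP vt; have [vt' _ _ _] := vt.
set t' := trunc _ t in vt' *; set U := uncovered t K; set U' := uncovered t' K.
have UU' : (U `<=` U')%fset.
  apply/fsubsetP => g; rewrite !inE => /andP[-> /asboolPn ng]/=.
  by apply/asboolPn => g'; apply: ng; exact: covered_trunc g'.
have bound f : f \in F -> #|` [fset g in U | `[< covered t (g * f)%g >]]%fset|%:R
    <= #|` U'|%:R - #|` U|%:R + 5 * eta * #|` K|%:R.
  move=> fF; have fE : f \in E by apply: (fsubsetP (FE F _)) fF; rewrite mem_head.
  have := tile_boundary_count d12 eta0 F1 fF FE lev KP vt'.
  set A := [fset g in K | _]%fset => cardA.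
  pose B1 := [fset x in K | (x * f)%g \notin K]%fset.
  pose B2 := [fset x in K | (x * f)%g \in (U' `\` U)%fset]%fset.
  have sub : ([fset g in U | `[< covered t (g * f)%g >]] `<=` A `|` (B1 `|` B2))%fset.
    apply/fsubsetP => g; rewrite !inE => /andP[/andP[gK /asboolPn ng] /asboolP gf].
    rewrite gK /=.
    have [gfK|] := boolP ((g * f)%g \in K); rewrite ?orbT//=.
    have [c|nc] := pselect (covered t' (g * f)%g).
      apply/orP; left; apply/asboolP; split => // g'; apply: ng.
      exact: covered_trunc g'.
    by apply/orP; right; rewrite negbK; apply/andP; split; [apply/asboolP|apply/asboolPn].
  have := leq_trans (card_fsubU_le sub) _.
  move=> /(_ (#|` A| + (#|` B1| + #|` B2|))%N); rewrite leq_add2l => /(_ (leq_card_fsetU _ _).1).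
  have B2U : (#|` B2| <= #|` U' `\` U|%fset)%N.
    apply: (@card_fset_le_inj _ _ _ _ (fun g => (g * f)%g)); first by move=> a b /mulIg.
    by move=> g; rewrite !inE => /andP[].
  have cardU : (#|` U| + #|` U' `\` U|%fset = #|` U'|)%N.
    by rewrite -(cardfsID U U') (fsetIidPr UU').
  have B1K : (#|` B1|%:R : R) <= eta * #|` K|%:R by apply: Kst; exact: sub_products.
  move: B2U cardA; rewrite -cardU -!(ler_nat R) !natrD; lra.
have F0 : (0 : R) < #|` F|%:R by rewrite ltr0n cardfs_gt0; apply/fset0Pn; exists 1%g.
have : d * #|` F|%:R * #|` U|%:R <=
    #|` F|%:R * (#|` U'|%:R - #|` U|%:R + 5 * eta * #|` K|%:R).
  apply: (@le_trans _ _ (\sum_(g <- U) #|` [fset f in F | `[< covered t (g * f)%g >]]%fset|)%N%:R).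
    rewrite natr_sum [leRHS]big_seq; apply: (@le_trans _ _ (\sum_(g <- U | g \in U) d * #|` F|%:R)).
      by rewrite -big_seq big_const_seq count_predT iter_addr_0 -[leRHS]mulr_natr.
    apply: ler_sum => g; rewrite !inE => /andP[_ /asboolPn ng].
    exact: uncovered_neighbors F1 vt ng.
  rewrite (double_count U F (fun g f => `[< covered t (g * f)%g >])).
  rewrite natr_sum big_seq; apply: le_trans (_ : _ <= \sum_(f <- F | f \in F) _) _.
    by apply: ler_sum => f; exact: bound.
  by rewrite -big_seq big_const_seq count_predT iter_addr_0 -[leLHS]mulr_natl.
rewrite mulrAC [X in X <= _]mulrC ler_pM2l//; lra.
Qed.

Fixpoint levels_stable d eta Fs : Prop :=
  if Fs is F :: Fs' then
    [/\ 1%g \in F, forall F', F' \in Fs' -> level_stable d eta F F' &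
        levels_stable d eta Fs']
  else True.

(** The recurrence $(1+d)u \le u' + v$ with $v = 5\eta|K|$ has the fixed point $v/d$; the excess
    over it shrinks by $1/(1+d)$ at each level. *)
Lemma uncovered_bound d eta E K Fs t :
  0 < d -> d <= 1 / 2 -> 0 <= eta ->
  (forall F, F \in Fs -> (F `<=` E)%fset) -> levels_stable d eta Fs ->
  stable (products E) eta K -> #|` thicken K (products E)|%:R <= 2 * #|` K|%:R :> R ->
  valid d Fs t ->
  (1 + d) ^+ size Fs * (#|` uncovered t K|%:R - 5 * eta * #|` K|%:R / d)
    <= #|` K|%:R.
Proof.
move=> d0 d12 eta0 FE lev Kst KP; elim: Fs t FE lev => [|F Fs IH] t FE.
  move=> _ _; rewrite expr0 mul1r.
  have : (#|` uncovered t K| <= #|` K|)%N.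
    by apply: fsubset_leq_card; apply/fsubsetP => g; rewrite !inE => /andP[].
  rewrite -(ler_nat R); have : 0 <= 5 * eta * #|` K|%:R / d.
    by rewrite divr_ge0 ?mulr_ge0// ltW.
  lra.
move=> [F1 lev levs] vt; have [vt' _ _ _] := vt.
have step := uncovered_step d12 eta0 F1 FE lev Kst KP vt.
have FE' F' : F' \in Fs -> (F' `<=` E)%fset.
  by move=> F'Fs; apply: FE; rewrite inE F'Fs orbT.
apply: le_trans (IH _ FE' levs vt'); rewrite /= exprSr -mulrA ler_wpM2l//.
  by rewrite exprn_ge0//; lra.
set v := 5 * eta * _ in step *.
have -> : (1 + d) * (#|` uncovered t K|%:R - v / d) =
    (1 + d) * #|` uncovered t K|%:R - v - v / d by field; rewrite gt_eqF.
lra.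
Qed.

End Covering.

(** * Word length and Følner sets *)

Section WordLength.
Context {G : groupType} (S : genset G).
Implicit Types (g h s : G) (K F : {fset G}).

Lemma word_length_spells g : spells S g (word_length S g).
Proof. by rewrite /word_length; case: ex_minnP => n /asboolP. Qed.

Lemma word_length_le g n : spells S g n -> (word_length S g <= n)%N.
Proof.
by rewrite /word_length => gn; case: ex_minnP => m _; apply; exact/asboolP.
Qed.

Lemma word_length1 : word_length S 1%g = 0%N.
Proof.
apply/eqP; rewrite -leqn0; apply: word_length_le; exists [::].
by rewrite big_nil.
Qed.

Lemma word_lengthM g h :
  (word_length S (g * h)%g <= word_length S g + word_length S h)%N.
Proof.
have [v [vS <- <-]] := word_length_spells g.
have [w [wS <- <-]] := word_length_spells h.
apply: word_length_le; exists (v ++ w); split; last by rewrite big_cat.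
  by rewrite /is_word all_cat; apply/andP.
by rewrite size_cat.
Qed.

Lemma word_lengthV g : word_length S g^-1%g = word_length S g.
Proof.
suff le h : (word_length S h^-1%g <= word_length S h)%N.
  by apply/eqP; rewrite eqn_leq le -{1}(invgK g) le.
have [w [/allP wS <- <-]] := word_length_spells h.
apply: word_length_le; exists (rev [seq s^-1%g | s <- w]); split.
- apply/allP => s; rewrite mem_rev => /mapP[u uw ->].
  by rewrite invgK orbC; exact: wS.
- by rewrite size_rev size_map.
- elim: w {wS} => [|s w IH]; first by rewrite !big_nil invg1.
  by rewrite map_cons rev_cons -cats1 big_cat /= big_seq1 big_cons IH invgM.
Qed.

Lemma mem_ball r g : Defs.ball S r g <-> (word_length S g <= r)%N.
Proof. by rewrite /Defs.ball /= /word_dist invg1 mul1g. Qed.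

Lemma moves_step K c : (word_length S c <= 1)%N ->
  (moves K c <= #|` fset_set (boundary S 1 K)|)%N.
Proof.
move=> c1; apply: fsubset_leq_card; apply/fsubsetP => x; rewrite !inE => /andP[xK xcK].
rewrite in_fset_set; last exact: finite_boundary.
rewrite inE; split; first by exists 1%g; [apply/mem_ball; rewrite word_length1|rewrite mulg1].
by exists c => //; apply/mem_ball.
Qed.

Lemma movesM K c c' : (moves K (c * c')%g <= moves K c + moves K c')%N.
Proof.
rewrite /moves addnC.
set A := [fset x in K | (x * c')%g \notin K]%fset.
pose B := [fset (x * c^-1)%g | x in A]%fset.
have -> : #|` A| = #|` B| by rewrite [RHS]card_imfset// => ? ? /mulIg.
apply: card_fsubU_le; apply/fsubsetP => x; rewrite !inE /= => /andP[xK xcc].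
rewrite xK /=; have [xc|] := boolP ((x * c)%g \in K); rewrite ?orbT// orbF.
apply/imfsetP; exists (x * c)%g; last by rewrite mulgK.
by rewrite !inE xc -mulgA.
Qed.

(** Telescoping along a shortest word for [c]. *)
Lemma moves_boundary K c :
  (moves K c <= word_length S c * #|` fset_set (boundary S 1 K)|)%N.
Proof.
have [w [wS <- <-]] := word_length_spells c.
elim: w wS => [_|s w IH /= /andP[sS wS]].
  rewrite big_nil /moves (_ : [fset _ in _ | _]%fset = fset0) ?cardfs0//.
  by apply/fsetP => x; rewrite !inE mulg1 andbN.
rewrite big_cons (leq_trans (movesM _ _ _))// mulSn leq_add ?IH//.
apply: moves_step; apply: word_length_le; exists [:: s].
by split; rewrite ?big_seq1//= sS.
Qed.

(** With empty boundary, right multiplication would never leave [K], and [G] would be finite.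
    Consequently a small [rho] forces a large set. *)
Lemma boundary_neq0 K : infinite_set [set: G] -> K != fset0 ->
  (0 < #|` fset_set (boundary S 1 K)|)%N.
Proof.
move=> Ginf /fset0Pn[x xK]; rewrite lt0n; apply/negP => /eqP b0; apply: Ginf.
apply: (@sub_finite_set _ _ [set` [fset (x^-1 * y)%g | y in K]%fset]); last exact: finite_fset.
move=> c _ /=; apply/imfsetP; exists (x * c)%g; last by rewrite mulKg.
have := moves_boundary K c; rewrite b0 muln0 leqn0 cardfs_eq0 => /eqP m0.
apply: contraT => xc; suff : x \in @fset0 G by rewrite inE.
by rewrite -m0 !inE xK.
Qed.

(** A boundary point $g$ has $gb \in K$ and $gb' \notin K$, so $b^{-1}b'$ carries $gb$ out of
    $K$. *)
Lemma card_boundary_le r K :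
  (#|` fset_set (boundary S r K)| <=
   \sum_(b <- fset_set (Defs.ball S r)) \sum_(b' <- fset_set (Defs.ball S r)) moves K (b^-1 * b'))%N.
Proof.
pose X b b' := [fset (x * b^-1)%g | x in [fset x in K | (x * (b^-1 * b'))%g \notin K]]%fset.
pose B := fset_set (Defs.ball S r).
have inB b : Defs.ball S r b -> b \in B.
  by move=> bB; rewrite in_fset_set ?inE//; exact: finite_ball.
apply: (@leq_trans #|` \bigcup_(b <- B) \bigcup_(b' <- B) X b b'|%fset).
  apply: fsubset_leq_card; apply/fsubsetP => g.
  rewrite in_fset_set ?inE; last exact: finite_boundary.
  move=> [[b bB gbK] [b' b'B gb'K]].
  apply/bigfcupP; exists b; first by rewrite inB.
  apply/bigfcupP; exists b'; first by rewrite inB.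
  apply/imfsetP; exists (g * b)%g; last by rewrite mulgK.
  by rewrite !inE gbK mulgA mulgK.
rewrite (leq_trans (card_bigfcup_le _ _))//; apply: leq_sum => b _.
rewrite (leq_trans (card_bigfcup_le _ _))//; apply: leq_sum => b' _.
exact: leq_imfset_card.
Qed.

End WordLength.

(** * Stable sets in an amenable group *)

Section Folner.
Context {R : realType} {G : groupType} (S : genset G).
Implicit Types (K F P : {fset G}) (eta : R).

Lemma invariant_stable P eta : 0 < eta -> exists2 delta : R, 0 < delta &
  forall K, Defs.invariant S 1 delta K -> stable P eta K.
Proof.
move=> eta0; pose m := (\max_(c <- P) word_length S c)%N.
(* The successor keeps the denominator positive when [m] is 0. *)
exists (eta / m.+1%:R); first by rewrite divr_gt0.
move=> K [K0 rhoK] c cP.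
have cm : (word_length S c <= m)%N by rewrite /m (@leq_bigmax_seq _ _ _ (word_length S)).
have K0' : (0 : R) < #|` K|%:R by rewrite ltr0n cardfs_gt0.
have := leq_trans (moves_boundary S K c) (leq_mul cm (leqnn _)).
rewrite -(ler_nat R) natrM => /le_trans; apply.
move: rhoK; rewrite /rho ler_pdivrMr// => b.
apply: (@le_trans _ _ (m.+1%:R * #|` fset_set (boundary S 1 K)|%:R)).
  by rewrite ler_wpM2r// ler_nat.
apply: (le_trans (ler_wpM2l _ b)) => //.
by rewrite mulrA mulrCA mulfV ?mulr1// pnatr_eq0.
Qed.

Lemma folner_stable (F : nat -> {fset G}) P eta : folner R S F -> 0 < eta ->
  \forall n \near \oo, stable P eta (F n).
Proof.
move=> [F0 Fr] eta0; have [delta d0 st] := invariant_stable P eta0.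
have /cvgrPdist_le/(_ _ d0) := Fr 1%N.
apply: filterS => n; rewrite sub0r normrN => h; apply: st; split => //.
by rewrite (le_trans (ler_norm _) h).
Qed.

Lemma moves_translate K c g : moves (translate g K) c = moves K c.
Proof.
have -> : moves K c = #|` translate g [fset x in K | (x * c)%g \notin K]%fset|.
  by rewrite [RHS]card_imfset//; exact: mulgI.
congr #|` _|; apply/fsetP => y; rewrite !inE /=; apply/andP/imfsetP.
  move=> [/imfsetP[x xK ->] nK]; exists x => //; rewrite !inE xK /=.
  by apply: contra nK => xcK; apply/imfsetP; exists (x * c)%g; rewrite ?mulgA.
move=> [x /=]; rewrite !inE => /andP[xK xcK] ->; split.
  by apply/imfsetP; exists x.
by apply: contra xcK => /imfsetP[z /= zK]; rewrite -mulgA => /mulgI ->.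
Qed.

Lemma stable_exists P eta m : infinite_set [set: G] -> amenable R S -> 0 < eta ->
  exists F, [/\ 1%g \in F, (m < #|` F|)%N & stable P eta F].
Proof.
move=> Ginf [F Fol] eta0; have [F0 Fr] := Fol.
have m0 : 0 < (m.+1%:R)^-1 :> R by rewrite invr_gt0.
have /cvgrPdist_lt/(_ _ m0) big := Fr 1%N.
have [n [/= rn st]] : exists n : nat, `|0 - rho R S 1 (F n)| < m.+1%:R^-1 /\ stable P eta (F n).
  apply: (@filter_ex _ \oo); apply: filterI => //; exact: folner_stable.
have /fset0Pn[x xF] := F0 n.
exists (translate x^-1%g (F n)); split.
- by apply/imfsetP; exists x => //; rewrite mulVg.
- rewrite card_imfset; last exact: mulgI.
  have K0 : (0 : R) < #|` F n|%:R by rewrite ltr0n cardfs_gt0.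
  rewrite -(ltr_nat R) ltNge; apply/negP => small.
  move: rn; rewrite sub0r normrN ltNge => /negP; apply.
  rewrite ger0_norm ?divr_ge0// /rho ler_pdivlMr//.
  apply: (@le_trans _ _ 1); last by rewrite ler1n boundary_neq0.
  by rewrite mulrC ler_pdivrMr// mul1r (le_trans small)// ler_nat.
- by move=> c cP; rewrite moves_translate card_imfset; [exact: st|exact: mulgI].
Qed.

(** Deleting at most $d|F|$ points raises [moves] by at most that much, and $|F| \le 2|A|$; hence
    each pair from the ball contributes at most $4d|A|$. *)
Lemma tile_invariant r (d : R) F A : d <= 1 / 2 ->
  (forall b b', Defs.ball S r b -> Defs.ball S r b' -> (moves F (b^-1 * b'))%:R <= d * #|` F|%:R) ->
  A \in shapes d F ->
  Defs.invariant S r (4 * d * #|` fset_set (Defs.ball S r)|%:R ^+ 2) A.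
Proof.
move=> d12 mF Ash; have A0 := shape_neq0 Ash; split => //.
have /shapesP[AF _ szA] := Ash.
have A0' : (0 : R) < #|` A|%:R by rewrite ltr0n cardfs_gt0.
rewrite /rho ler_pdivrMr//.
have := card_boundary_le S r A; rewrite -(ler_nat R) => /le_trans; apply.
set B := fset_set (Defs.ball S r).
have inB b : b \in B -> Defs.ball S r b.
  by rewrite in_fset_set ?inE//; exact: finite_ball.
have mA b b' : b \in B -> b' \in B -> (moves A (b^-1 * b'))%:R <= 4 * d * #|` A|%:R.
  move=> /inB bB /inB b'B; have := mF _ _ bB b'B; set c := (b^-1 * b')%g => mc.
  have : (moves A c <= moves F c + #|` F `\` A|%fset)%N.
    pose C := [fset (x * c^-1)%g | x in (F `\` A)%fset]%fset.
    have -> : #|` F `\` A|%fset = #|` C| by rewrite [RHS]card_imfset// => ? ? /mulIg.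
    apply: card_fsubU_le; apply/fsubsetP => x; rewrite !inE /= => /andP[xA xcA].
    rewrite (fsubsetP AF _ xA)/=; have [xcF|] //= := boolP ((x * c)%g \in F).
    by apply/imfsetP; exists (x * c)%g; rewrite ?mulgK// !inE xcA.
  have : (#|` A| + #|` F `\` A|%fset = #|` F|)%N.
    by rewrite -[in RHS](cardfsID A F) (fsetIidPr AF).
  move=> /(congr1 (fun n => n%:R : R)); rewrite natrD -(ler_nat R) natrD => FA mAc.
  have F0 : (0 : R) < #|` F|%:R by rewrite (lt_le_trans A0')// ler_nat fsubset_leq_card.
  have d0 : 0 <= d by rewrite -(pmulr_lge0 _ F0) (le_trans _ mc).
  have F2A : #|` F|%:R <= 2 * #|` A|%:R :> R.
    by have := ler_wpM2r (ltW F0) d12; lra.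
  have := ler_wpM2l d0 F2A; lra.
rewrite natr_sum big_seq.
apply: (@le_trans _ _ (\sum_(b <- B | b \in B) (#|` B|%:R * (4 * d * #|` A|%:R)))).
  apply: ler_sum => b bB; rewrite natr_sum big_seq.
  apply: (@le_trans _ _ (\sum_(b' <- B | b' \in B) (4 * d * #|` A|%:R))).
    by apply: ler_sum => b' b'B; exact: mA.
  by rewrite -big_seq big_const_seq count_predT iter_addr_0 -[leLHS]mulr_natl.
rewrite -big_seq big_const_seq count_predT iter_addr_0 -[leLHS]mulr_natl.
by rewrite le_eqVlt; apply/orP; left; apply/eqP; ring.
Qed.

End Folner.

(** * Shearer's inequality and entropy *)

Section Holder.
Context {R : realType} {I J : finType}.

(** A Hölder inequality. After division by [V], the means inequality over the [k] indices in [A]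
    bounds each [u j], the other factors being at most 1. In Shearer's induction [j] is the letter
    at a coordinate and [A] the set of windows containing it. *)
Lemma holder_sum (A : {pred I}) (k : nat) (u : J -> R) (v : J -> I -> R) (V : I -> R) :
  (0 < k)%N -> #|A| = k -> (forall i, 0 < V i) ->
  (forall j, 0 <= u j) -> (forall j i, 0 <= v j i) ->
  (forall j, u j ^+ k <= \prod_i v j i) ->
  (forall i, i \in A -> \sum_j v j i <= V i) ->
  (forall i j, i \notin A -> v j i <= V i) ->
  (\sum_j u j) ^+ k <= \prod_i V i.
Proof.
move=> k0 Ak V0 u0 v0 uv vV vV'.
have P0 : 0 < \prod_i V i by apply: prodr_gt0.
pose w : R := (\prod_i V i) `^ k%:R^-1.
have w0 : 0 < w by apply: powR_gt0.
have wk : w ^+ k = \prod_i V i.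
  by rewrite -powR_mulrn ?ltW// -powRrM mulVf ?powRr1 ?ltW// pnatr_eq0 -lt0n.
have uw j : u j / w <= (\sum_(i in A) v j i / V i) / k%:R.
  have r0 : 0 <= \sum_(i in A) v j i / V i by apply: sumr_ge0 => i _; rewrite divr_ge0// ltW.
  rewrite -(@ler_pXn2r _ k)// ?nnegrE ?divr_ge0// ?(ltW w0)//.
  rewrite expr_div_n wk.
  apply: (@le_trans _ _ (\prod_i (v j i / V i))).
    by rewrite big_split prodfV/= ler_wpM2r// invr_ge0 ltW.
  rewrite (bigID (mem A))/=; apply: (@le_trans _ _ (\prod_(i in A) (v j i / V i))).
    rewrite ler_piMr ?prodr_ge0//; first by move=> i _; rewrite divr_ge0// ltW.
    by apply: prodr_ile1 => i iA; rewrite divr_ge0 ?(ltW (V0 _))//= ler_pdivrMr// mul1r vV'.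
  rewrite -Ak; have [|+ _] := @leif_AGM _ _ A (fun i => v j i / V i); last by [].
  by move=> i _; rewrite divr_ge0// ltW.
rewrite -wk lerXn2r ?nnegrE ?sumr_ge0 ?(ltW w0)//.
rewrite -[leRHS]mul1r -ler_pdivrMr// mulr_suml.
apply: (le_trans (ler_sum _ (fun j _ => uw j))).
rewrite -mulr_suml exchange_big/= ler_pdivrMr ?ltr0n// mul1r.
apply: (@le_trans _ _ (\sum_(i in A) 1)); last by rewrite sumr_const Ak.
by apply: ler_sum => i iA; rewrite -mulr_suml ler_pdivrMr// mul1r vV.
Qed.

End Holder.

Section Words.
Context {R : realType} {G : choiceType} {A : finType}.
Implicit Types (X : set (G -> A)) (s : seq G).

(** Patterns are read along a list so that coordinates can be removed one at a time; [card_patterns]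
    shows that the count is the same. *)
Definition words X s : set (seq A) := [set map x s | x in X].

Lemma finite_words X s : finite_set (words X s).
Proof.
apply: (@sub_finite_set _ _ (@tval (size s) A @` setT)).
  by move=> _ [x Xx <-]; exists (map_tuple x (in_tuple s)).
exact/finite_image/finite_finset.
Qed.

Definition nwords X s : nat := #|` fset_set (words X s)|.

Lemma mem_words X s w : (w \in fset_set (words X s)) <-> words X s w.
Proof. by rewrite in_fset_set ?inE//; exact: finite_words. Qed.

Lemma nwords_gt0 X s : X !=set0 -> (0 < nwords X s)%N.
Proof.
move=> [x Xx]; rewrite cardfs_gt0; apply/fset0Pn; exists (map x s).
by apply/mem_words; exists x.
Qed.

Lemma nwords_eq0 X s : ~ (X !=set0) -> nwords X s = 0%N.
Proof.
move=> X0; apply/eqP; rewrite cardfs_eq0; apply/eqP/fsetP => w; rewrite inE.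
by apply/negP => /mem_words[x Xx _]; apply: X0; exists x.
Qed.

Lemma nwords_nil X : (nwords X [::] <= 1)%N.
Proof.
rewrite -(cardfs1 ([::] : seq A)); apply/fsubset_leq_card/fsubsetP => w.
by move=> /mem_words[x _ <-]; rewrite inE.
Qed.

Lemma nwords_cons X g s :
  nwords X (g :: s) = (\sum_(a : A) nwords (X `&` [set x | x g = a]) s)%N.
Proof.
have E a : nwords (X `&` [set x | x g = a]) s =
    #|` [fset w in fset_set (words X (g :: s)) | ohead w == Some a]%fset|.
  have -> : [fset w in fset_set (words X (g :: s)) | ohead w == Some a]%fset =
    [fset a :: w | w in fset_set (words (X `&` [set x | x g = a]) s)]%fset.
    apply/fsetP => w; rewrite !inE /=; apply/andP/imfsetP.
      move=> [/mem_words[x Xx <-] /eqP[xa]]; exists (map x s); last by rewrite /= xa.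
      by apply/mem_words; exists x.
    move=> [v /= /mem_words[x [Xx /= xa] <-] ->]; split; last by rewrite /= eqxx.
    by apply/mem_words; exists x; rewrite //= xa.
  by rewrite card_imfset// => ? ? [].
rewrite (eq_bigr _ (fun a _ => E a)).
under eq_bigr do rewrite card_fset_filter.
rewrite exchange_big /= /nwords card_fset_sum1 big_seq [RHS]big_seq.
apply: eq_bigr => w /mem_words[x _ <-] /=.
rewrite (bigD1 (x g))//= eqxx big1 ?addn0// => a /negbTE ag.
by case: eqP => [[e]|//]; rewrite e eqxx in ag.
Qed.

Lemma nwords_sub X s s' : {subset s <= s'} -> (nwords X s <= nwords X s')%N.
Proof.
move=> ss'; have [Xn0|/nwords_eq0 ->//] := pselect (X !=set0).
case: s ss' => [|g s] ss'; first by rewrite (leq_trans (nwords_nil X))// nwords_gt0.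
have [x0 Xx0] := Xn0.
(* The default letter [x0 g] is never read, since every [h] occurs in [s']. *)
pose f (w : seq A) := [seq nth (x0 g) w (index h s') | h <- g :: s].
apply: (@leq_trans #|` [fset f w | w in fset_set (words X s')]%fset|); last first.
  exact: leq_imfset_card.
apply/fsubset_leq_card/fsubsetP => w /mem_words[x Xx <-]; apply/imfsetP.
exists (map x s'); first by apply/mem_words; exists x.
apply/eq_in_map => h /ss' hs'.
by rewrite (nth_map g) ?index_mem// nth_index.
Qed.

(** Induction on coordinates. Fixing the letter at [g] splits the words of windows containing [g]
    and can only lower the counts of the others; [holder_sum] recombines the letters. *)
Lemma shearer (I : finType) (B : I -> pred G) k X s : (0 < k)%N ->
  (forall g, g \in s -> #|[pred i | B i g]| = k) ->
  (nwords X s)%:R ^+ k <= \prod_i (nwords X (seq.filter (B i) s))%:R :> R.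
Proof.
move=> k0; elim: s X => [|g s IH] X Bk.
  have [Xn0|/nwords_eq0 e] := pselect (X !=set0); last first.
    by rewrite e expr0n (gtn_eqF k0) prodr_ge0.
  have -> : nwords X [::] = 1%N.
    by apply/eqP; rewrite eqn_leq nwords_nil nwords_gt0.
  by rewrite expr1n big1.
have [Xn0|/nwords_eq0 e] := pselect (X !=set0); last first.
  by rewrite e expr0n (gtn_eqF k0) prodr_ge0.
rewrite nwords_cons natr_sum.
pose v a i : R := (nwords (X `&` [set x | x g = a]) (seq.filter (B i) s))%:R.
apply: (@holder_sum R I A [pred i | B i g] k _ v) => //.
- by apply: Bk; rewrite mem_head.
- by move=> i; rewrite ltr0n nwords_gt0.
- by move=> a; apply: IH => h hs; apply: Bk; rewrite inE hs orbT.
- by move=> i; rewrite inE /= => ->; rewrite nwords_cons natr_sum.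
- move=> i a; rewrite inE /= => /negbTE ->; rewrite ler_nat.
  apply/fsubset_leq_card/fsubsetP => w /mem_words[x [Xx _] <-].
  by apply/mem_words; exists x.
Qed.

End Words.

(** * Entropy as an infimum over finite sets *)

Section Entropy.
Context {R : realType} {G : groupType} {A : finType}.
Implicit Types (X : set (G -> A)) (F K : {fset G}).

Lemma card_patterns X K : #|` fset_set (patterns X K)| = nwords X K.
Proof.
pose f (p : {ffun K -> A}) := [seq p k | k <- enum {: K}].
have f_inj : injective f.
  move=> p q /eq_in_map pq; apply/ffunP => k; apply: pq.
  by rewrite mem_enum.
have fE x : f (restrict_to K x) = map x K.
  rewrite enum_fsetE -map_comp; apply: eq_map => k /=.
  by rewrite ffunE.
rewrite /nwords; have -> : fset_set (words X K) = [fset f p | p in fset_set (patterns X K)]%fset.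
  have fin : finite_set (patterns X K) by exact: finite_finset.
  apply/fsetP => w; apply/idP/imfsetP => /=.
    move=> /mem_words[x Xx <-]; exists (restrict_to K x) => //.
    by rewrite in_fset_set// inE; exists x.
  move=> [p]; rewrite in_fset_set// inE => -[x Xx <-] ->; rewrite fE.
  by apply/mem_words; exists x.
by rewrite card_imfset.
Qed.

Lemma nwords_translate X g (s : seq G) : is_shift X ->
  (nwords X [seq (g * h)%g | h <- s] <= nwords X s)%N.
Proof.
move=> [_ _ Xinv]; apply/fsubset_leq_card/fsubsetP => w /mem_words[x Xx <-].
apply/mem_words; exists (translation g^-1%g x); first exact: Xinv.
by rewrite -map_comp; apply: eq_map => h /=; rewrite /translation invgK.
Qed.

(** Each $f \in F$ lies in exactly $|K|$ of the translates $iK$ with $i \in FK^{-1}$, namely those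
    with $i \in fK^{-1}$. Shearer's inequality applies to these windows. *)
Lemma nwords_cover X F K : is_shift X -> F != fset0 -> K != fset0 ->
  #|` K|%:R * ln (nwords X F)%:R <=
  #|` thicken F [fset c^-1%g | c in K]%fset|%:R * ln (nwords X K)%:R :> R.
Proof.
move=> Xsh F0 K0; have [Xn0 _ _] := Xsh.
set T := thicken _ _.
pose B (i : T) : pred G := [pred f | f \in translate (val i) K].
have k0 : (0 < #|` K|)%N by rewrite cardfs_gt0.
have Bk f : f \in F -> #|[pred i | B i f]| = #|` K|.
  move=> fF.
  have mem c : c \in K -> (f * c^-1)%g \in T.
    by move=> cK; apply/imfset2P; exists f => //; exists c^-1%g => //; apply/imfsetP; exists c.
  pose phi (c : K) : T := [` mem (val c) (valP c)]%fset.
  have phi_inj : injective phi by move=> c c' /(congr1 val)/= /mulgI/invg_inj/val_inj.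
  rewrite cardfE -(card_codom phi_inj); apply: eq_card => i; rewrite !inE.
  apply/imfsetP/codomP => [[c /= cK fc]|[c ->]].
    by exists [` cK]%fset; apply: val_inj; rewrite /= fc mulgK.
  by exists (val c); rewrite ?mulgVK//; exact: valP.
have := shearer (R := R) X k0 Bk.
have pos s : (0 : R) < (nwords X s)%:R by rewrite ltr0n nwords_gt0.
have : \prod_i (nwords X (seq.filter (B i) F))%:R <= (nwords X K)%:R ^+ #|` T| :> R.
  rewrite cardfE -prodr_const; apply: ler_prod => i _; rewrite ler0n ler_nat /=.
  apply: leq_trans (nwords_translate (val i) K Xsh); apply: nwords_sub => h.
  rewrite mem_filter => /andP[/imfsetP[c cK ->] _].
  by apply/mapP; exists c.
move=> /[swap] /le_trans /[apply].
rewrite -ler_ln ?posrE ?exprn_gt0// !lnXn//.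
by rewrite !mulr_natl.
Qed.

(** The sets [F n] are among those over which the infimum is taken. Conversely, for [K] near the
    infimum, [nwords_cover] bounds the ratio at [F n] by that at [K] times $|F_nK^{-1}|/|F_n|$,
    which tends to 1. *)
Lemma shift_entropy (S : genset G) X : is_shift X ->
  exists2 h : R, has_entropy S X h &
    forall K, K != fset0 -> h <= ln (nwords X K)%:R / #|` K|%:R.
Proof.
move=> Xsh; have [Xn0 _ _] := Xsh.
pose ratio K : R := ln (nwords X K)%:R / #|` K|%:R.
have ratio0 K : 0 <= ratio K by rewrite divr_ge0// ln_ge0// ler1n nwords_gt0.
pose V : set R := [set ratio K | K in [set K | K != fset0]].
have lbV : lbound V 0 by move=> _ [K _ <-].
have infV : has_inf V.
  split; last by exists 0.
  by exists (ratio [fset 1%g]%fset), [fset 1%g]%fset => //=; rewrite -cardfs_gt0 cardfs1.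
exists (inf V); last by move=> K K0; apply: ge_inf; [exists 0|exists K].
move=> F Fol; have [F0 _] := Fol; apply/cvgrPdist_le => e e0.
have e20 : 0 < e / 2 by rewrite divr_gt0.
have [_ [K K0 <-] Ke] := inf_adherent e20 infV.
have k0 : (0 : R) < #|` K|%:R by rewrite ltr0n cardfs_gt0.
pose Ki := [fset c^-1%g | c in K]%fset.
(* Adding 1 keeps [D] positive when the ratio vanishes; stability with constant [e / 2 / D] makes
   the thickening cost at most [e / 2]. *)
pose D := #|` Ki|%:R * ratio K + 1.
have D0 : 0 < D by rewrite ltr_wpDl// mulr_ge0.
have eD0 : 0 < e / 2 / D by rewrite divr_gt0.
apply: filterS (folner_stable Ki Fol eD0) => n /card_thicken cT.
have f0 : (0 : R) < #|` F n|%:R by rewrite ltr0n cardfs_gt0.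
rewrite card_patterns -/(ratio (F n)).
have hn : inf V <= ratio (F n) by apply: ge_inf; [exists 0|exists (F n) => //; exact: F0].
rewrite ler0_norm ?subr_le0// opprB lerBlDl.
apply: (@le_trans _ _ (ratio K + e / 2)); last by move: Ke; lra.
have := @nwords_cover X (F n) K Xsh (F0 n) K0; rewrite -/Ki => cover.
rewrite /ratio ler_pdivrMr//.
have -> : ln (nwords X (F n))%:R = (#|` K|%:R * ln (nwords X (F n))%:R) / #|` K|%:R :> R.
  by rewrite mulrAC mulfV ?mul1r// gt_eqF.
rewrite ler_pdivrMr//; apply: (le_trans cover).
have lnK : ln (nwords X K)%:R = ratio K * #|` K|%:R :> R by rewrite /ratio mulfVK// gt_eqF.
rewrite lnK mulfK ?gt_eqF// mulrA ler_pM2r//.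
apply: le_trans (ler_wpM2r (ratio0 K) cT) _.
have : #|` Ki|%:R * (e / 2 / D) * ratio K <= e / 2.
  rewrite mulrAC mulrCA ger_pMr// ler_pdivrMr// /D; lra.
set q := #|` Ki|%:R * _ => qe; have := ler_wpM2r (ltW f0) qe; lra.
Qed.

End Entropy.

(** * Entropy of tile configurations *)

Section EntropyBound.
Context {R : realType} {G : groupType}.
Implicit Types (E F K A : {fset G}) (d gam lam : R).

Lemma sum_fset_le (T : finType) (Y : {fset T}) (f : T -> R) :
  (forall p, 0 <= f p) -> \sum_(p <- Y) f p <= \sum_p f p.
Proof.
move=> f0; rewrite big_uniq ?fset_uniq//= big_mkcond/=.
by apply: ler_sum => p _; case: ifP.
Qed.

(* Weighting the subsets [A] of [F] by [lam ^ #|F \ A|] gives total weight [(1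
   + lam) ^ #|F|], and a shape has weight at least [lam ^ (d * #|F|)]. *)
Lemma card_shapes d lam F : 0 <= d -> 0 < lam -> lam <= 1 ->
  #|` shapes d F|%:R <= expR ((lam + d / lam) * #|` F|%:R).
Proof.
move=> d0 lam0 lam1; pose n := #|` F|.
pose wt (p : {ffun F -> bool}) : R := \prod_x (if p x then 1 else lam).
have wt0 p : 0 <= wt p by apply: prodr_ge0 => x _; case: ifP => // _; exact: ltW.
have total : \sum_p wt p = (1 + lam) ^+ n.
  rewrite -(bigA_distr_bigA (fun (x : F) (b : bool) => if b then 1 else lam)).
  rewrite (eq_bigr (fun=> 1 + lam)); last by move=> x _; rewrite big_bool.
  by rewrite prodr_const -cardfE.
pose f A : {ffun F -> bool} := [ffun x => val x \in A].
have f_inj : {in shapes d F &, injective f}.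
  move=> A B /shapesP[AF _ _] /shapesP[BF _ _] /ffunP AB; apply/fsetP => x.
  have [xF|xF] := boolP (x \in F); first by have := AB [` xF]%fset; rewrite !ffunE.
  have out C : (C `<=` F)%fset -> x \in C = false.
    by move=> CF; apply: contraNF xF; exact: (fsubsetP CF).
  by rewrite !out.
(* From $1 + x \le e^x$ at $x = 1/\lambda$; it turns powers of [lam] into exponentials. *)
have lamE : expR (- (1 / lam)) <= lam.
  rewrite expRN -[leRHS]invrK lef_pV2 ?posrE ?invr_gt0// ?expR_gt0//.
  have := expR_ge1Dx (1 / lam); rewrite mul1r; lra.
have low A : A \in shapes d F -> expR (- (d / lam * n%:R)) <= wt (f A).
  move=> /shapesP[AF _ szA].
  have -> : wt (f A) = lam ^+ #|` F `\` A|%fset.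
    rewrite /wt (eq_bigr (fun x => if x \in fsub F (F `\` A)%fset then lam else 1)).
      by rewrite -big_mkcond prodr_const card_fsub// fsubsetDl.
    by move=> x _; rewrite ffunE in_fsub inE (valP x) andbT; case: ifP.
  apply: (@le_trans _ _ (expR (- (1 / lam)) ^+ #|` F `\` A|%fset)); last first.
    by rewrite lerXn2r ?nnegrE ?expR_ge0// ltW.
  rewrite -expRM_natr ler_expR mulNr lerN2.
  have : (#|` A| + #|` F `\` A|%fset = #|` F|)%N.
    by rewrite -[in RHS](cardfsID A F) (fsetIidPr AF).
  move=> /(congr1 (fun n => n%:R : R)); rewrite natrD => FA.
  rewrite mul1r [leLHS]mulrC [leRHS]mulrAC ler_wpM2r ?invr_ge0 ?(ltW lam0)//.
  by move: szA; rewrite -FA /n; lra.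
have : #|` shapes d F|%:R * expR (- (d / lam * n%:R)) <= (1 + lam) ^+ n.
  rewrite -total; have <- : #|` [fset f A | A in shapes d F]%fset| = #|` shapes d F|.
    by rewrite card_in_imfset.
  set Y := [fset f A | A in _]%fset.
  apply: (@le_trans _ _ (\sum_(p <- Y) wt p)).
    rewrite mulr_natl -iter_addr_0 -(count_predT Y) -big_const_seq big_seq [leRHS]big_seq.
    by apply: ler_sum => _ /imfsetP[A /= Ash ->]; exact: low.
  exact: sum_fset_le.
move=> /(ler_wpM2r (expR_ge0 (d / lam * n%:R))).
rewrite -[X in X <= _]mulrA -expRD addNr expR0 mulr1 => /le_trans; apply.
rewrite mulrDl expRD ler_wpM2r ?expR_ge0// expRM_natr lerXn2r ?nnegrE ?expR_ge0//.
  by rewrite addr_ge0// ltW.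
exact: expR_ge1Dx.
Qed.

(* Weight a pattern by [expR (- gam * total size of its tiles)]: the weights
   factor over [K], and tiles starting in [K] occupy a set of size at most [2
   * #|K|]. *)
Lemma nwords_tiles gam (T : {fset {fset G}}) (X : set (G -> tiles T)) E K :
  0 <= gam ->
  (forall t, X t -> disjoint_tiles (fun g => val (t g))) ->
  (forall A, A \in T -> (A `<=` E)%fset) ->
  #|` thicken K E|%:R <= 2 * #|` K|%:R :> R ->
  (nwords X K)%:R <=
    expR ((2 * gam + \sum_(A <- T) expR (- (gam * #|` A|%:R))) * #|` K|%:R).
Proof.
move=> gam0 Xdis TE KE; rewrite -card_patterns.
pose wt (A : tiles T) : R := expR (- (gam * #|` val A|%:R)).
have low (p : {ffun K -> tiles T}) : patterns X K p ->
    1 <= expR (gam * (2 * #|` K|%:R)) * \prod_k wt (p k).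
  move=> [t Xt <-]; rewrite /wt -expR_sum -expRD -[leLHS]expR0 ler_expR.
  rewrite sumrN -mulr_sumr -mulrBr mulr_ge0// subr_ge0 (le_trans _ KE)//.
  rewrite -natr_sum ler_nat.
  have := @tiles_packing _ _ K (thicken K E) (Xdis _ Xt) (fset_uniq K).
  rewrite (big_seq_fsetE addn) /=.
  under [in X in _ -> X]eq_bigr do rewrite /restrict_to ffunE.
  apply => h a hK aA; apply/imfset2P; exists h => //; exists a => //.
  have := valP (t h); rewrite !inE => /orP[/eqP t0|/TE /fsubsetP]; last exact.
  by rewrite t0 inE in aA.
have fin : finite_set (patterns X K) by exact: finite_finset.
set Y := fset_set _.
apply: (@le_trans _ _ (\sum_(p <- Y) expR (gam * (2 * #|` K|%:R)) * \prod_k wt (p k))).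
  rewrite card_fset_sum1 natr_sum big_seq [leRHS]big_seq; apply: ler_sum => p.
  by rewrite in_fset_set// inE; exact: low.
rewrite -mulr_sumr.
apply: (@le_trans _ _ (expR (gam * (2 * #|` K|%:R)) * \sum_(p : {ffun K -> tiles T}) \prod_k wt (p k))).
  rewrite ler_wpM2l ?expR_ge0//.
  by apply: sum_fset_le => p; apply: prodr_ge0 => k _; exact: expR_ge0.
rewrite -(bigA_distr_bigA (fun _ => wt)) prodr_const -cardfE.
set sig := \sum_(A <- T) _.
have -> : expR ((2 * gam + sig) * #|` K|%:R) =
    expR (gam * (2 * #|` K|%:R)) * expR sig ^+ #|` K|.
  by rewrite -expRM_natr -expRD; congr expR; ring.
rewrite ler_wpM2l ?expR_ge0//.
have wt_ge0 : 0 <= \sum_A wt A by apply: sumr_ge0 => A _; exact: expR_ge0.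
rewrite lerXn2r ?nnegrE ?expR_ge0//.
(* The empty tile has weight 1, so the weights add up to at most [1 + sig]. *)
apply: le_trans (expR_ge1Dx _).
rewrite /wt -(big_seq_fsetE +%R (tiles T) xpredT (fun A => expR (- (gam * #|` A|%:R)))) /=.
rewrite /tiles /sig; have [T0|T0] := boolP (fset0 \in T).
  by rewrite mem_fset1U// lerDr.
by rewrite big_fsetU1// cardfs0 mulr0 oppr0 expR0.
Qed.

(** With [lam = gam / 8], a level $F$ has at most $e^{\gamma|F|/4}$ shapes. Each has at least
    $|F|/2$ points, hence weight at most $e^{-\gamma|F|/2}$, so the level contributes at most
    $e^{-\gamma|F|/4}$. *)
Lemma shapes_weight d gam (m : nat) (Fs : seq {fset G}) (T : {fset {fset G}}) :
  0 <= d -> d <= 1 / 2 -> 0 < gam -> gam <= 1 -> 64 * d <= gam ^+ 2 ->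
  (forall A, A \in T -> exists2 F, F \in Fs & A \in shapes d F) ->
  (forall F, F \in Fs -> (m <= #|` F|)%N) ->
  \sum_(A <- T) expR (- (gam * #|` A|%:R)) <=
    (size Fs)%:R * expR (- (gam / 4 * m%:R)).
Proof.
move=> d0 d12 gam0 gam1 dgam TFs mFs.
apply: (@le_trans _ _ (\sum_(A <- T) \sum_(F <- Fs) (A \in shapes d F)%:R * expR (- (gam / 2 * #|` F|%:R)))).
  rewrite big_seq [leRHS]big_seq; apply: ler_sum => A /TFs[F FFs AF].
  rewrite (big_rem F)//= AF mul1r -[leLHS]addr0 lerD//; last first.
    by apply: sumr_ge0 => F' _; rewrite mulr_ge0// expR_ge0.
  rewrite ler_expR lerN2 -mulrA ler_wpM2l// ?(ltW gam0)//.
  have /shapesP[_ _] := AF; have : (0 : R) <= #|` F|%:R by [].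
  nra.
rewrite exchange_big/=.
apply: (@le_trans _ _ (\sum_(F <- Fs) expR (- (gam / 4 * m%:R)))); last first.
  by rewrite big_const_seq count_predT iter_addr_0 mulr_natl.
rewrite big_seq [leRHS]big_seq; apply: ler_sum => F FFs.
rewrite -mulr_suml -natr_sum -card_fset_filter.
have gam80 : 0 < gam / 8 by rewrite divr_gt0.
have gam81 : gam / 8 <= 1 by lra.
have cS := card_shapes F d0 gam80 gam81.
apply: (@le_trans _ _ (#|` shapes d F|%:R * expR (- (gam / 2 * #|` F|%:R)))).
  rewrite ler_wpM2r ?expR_ge0// ler_nat; apply/fsubset_leq_card/fsubsetP => A.
  by rewrite 2!inE /= => /andP[].
apply: le_trans (ler_wpM2r (expR_ge0 _) cS) _.
rewrite -expRD ler_expR.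
have dg : d / (gam / 8) <= gam / 8.
  by rewrite ler_pdivrMr//; move: dgam; rewrite expr2; lra.
have := ler_wpM2r (ler0n R #|` F|) dg.
have : gam / 4 * m%:R <= gam / 4 * #|` F|%:R.
  by rewrite ler_wpM2l// ?ler_nat ?mFs// ltW// divr_gt0.
lra.
Qed.

End EntropyBound.

(** * Closedness of locally defined sets *)

Section Realize.
Context {R : realType} {G : groupType}.

Lemma closed_local (A : finType) (X : set (G -> A)) :
  (forall t, (forall W : {fset G}, exists2 s, X s & {in W, s =1 t}) -> X t) ->
  closed (X : set {ptws G -> discrete_topology A}).
Proof.
move=> loc t clt; apply: loc => W.
have /clt[s [Xs st]] : nbhs (t : {ptws G -> discrete_topology A})
    (\bigcap_(g in [set` W]) (proj g @^-1` [set t g] : set {ptws G -> discrete_topology A})).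
  apply: filter_bigI => g _.
  exact: (@proj_continuous G (fun=> discrete_topology A) g t _ (discrete_set1 _)).
by exists s => // g gW; exact: st.
Qed.

End Realize.

(** * The quasi-tiling shift *)

Section Assembly.
Context {R : realType} {G : groupType} (S : genset G).
Implicit Types (E F K A : {fset G}) (Fs : seq {fset G}) (d eta : R).

Lemma levels_stable_separated d eta Fs : levels_stable d eta Fs ->
  levels_separated d Fs.
Proof.
by elim: Fs => [//|F Fs IH] /= [_ lev /IH levs]; split => // F' /lev[].
Qed.

(** Built from the lowest level up: each new set is large and stable relative to all earlier ones,
    which are recorded in [L]. *)
Lemma levels_exist d eta m P n (L : seq {fset G}) :
  infinite_set [set: G] -> amenable R S -> 0 < d -> d <= 1 / 2 -> 0 < eta ->
  exists Fs, [/\ size Fs = n, levels_stable d eta Fs,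
    forall F, F \in Fs -> [/\ 1%g \in F, (m < #|` F|)%N & stable P d F] &
    forall F0 F, F0 \in L -> F \in Fs -> level_stable d eta F0 F].
Proof.
move=> Ginf Gam d0 d12 eta0; elim: n L => [|n IH] L; first by exists [::].
pose LV := (\bigcup_(F0 <- L) [fset c^-1%g | c in F0])%fset.
(* Having more than $2|F_0|$ points gives $|F_0| < (1-d)|F|$, as $d \le 1/2$. *)
pose M := (m + 2 * \max_(F0 <- L) #|` F0|)%N.
pose e := Num.min d eta.
have e0 : 0 < e by rewrite lt_min d0.
have [F [F1 FM Fst]] := stable_exists (P `|` LV)%fset M Ginf Gam e0.
have F0 : (0 : R) <= #|` F|%:R by [].
have FL F0' : F0' \in L -> level_stable d eta F0' F.
  move=> F0L; split.
    have : (2 * #|` F0'| < #|` F|)%N.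
      rewrite (leq_ltn_trans _ FM)// /M (leq_trans _ (leq_addl _ _))// leq_mul2l/=.
      by rewrite (@leq_bigmax_seq _ _ _ (fun F0 : {fset G} => #|` F0|)).
    rewrite /size_separated -(ltr_nat R) natrM; nra.
  move=> c cF0; have : stable (P `|` LV)%fset eta F.
    by move=> b bP; apply: le_trans (Fst b bP) _; rewrite ler_wpM2r// /e ge_min lexx orbT.
  apply; rewrite inE; apply/orP; right; apply/bigfcupP; exists F0'; first by rewrite F0L.
  by apply/imfsetP; exists c.
have [Fs [szFs lev Fsm FsL]] := IH (F :: L).
exists (F :: Fs); split.
- by rewrite /= szFs.
- by split => // F' F'Fs; apply: FsL => //; exact: mem_head.
- move=> F'; rewrite inE => /orP[/eqP ->|]; last exact: Fsm.
  split => //; first by rewrite (leq_ltn_trans _ FM)// leq_addr.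
  move=> b bP; apply: (le_trans (Fst b _)); first by rewrite inE bP.
  by rewrite ler_wpM2r// /e ge_min lexx.
- move=> F0' F'; rewrite inE => F0L /orP[/eqP ->|F'Fs]; first exact: FL.
  by apply: FsL => //; rewrite inE F0L orbT.
Qed.

Lemma word_dist_triangle g h k :
  (word_dist S g k <= word_dist S g h + word_dist S h k)%N.
Proof.
apply: leq_trans (word_lengthM S _ _).
by rewrite mulgA mulgK.
Qed.

Lemma word_dist_sym g h : word_dist S g h = word_dist S h g.
Proof. by rewrite /word_dist -word_lengthV invgM invgK. Qed.

Lemma iter_neighborhood_dist E l n (P : set G) g :
  (forall a, a \in E -> (word_length S a <= l)%N) ->
  iter n (neighborhood E) P g -> exists2 a, P a & (word_dist S a g <= n * (l + l))%N.
Proof.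
move=> El; elim: n g => [|n IH] g /=.
  by move=> Pg; exists g => //; rewrite /word_dist mulVg word_length1.
move=> [h /IH[a Pa ah] [b [c [bE cE hg]]]]; exists a => //.
rewrite (leq_trans (word_dist_triangle a h g))// mulSn addnC leq_add//.
rewrite /word_dist hg (leq_trans (word_lengthM S _ _))//.
by apply: leq_add; rewrite ?word_lengthV; exact: El.
Qed.

End Assembly.

(** * Valid configurations as a strongly irreducible shift *)

Section ValidShift.
Context {R : realType} {G : groupType} (S : genset G) (d : R) (Fs : seq {fset G}).
Implicit Types (E F K A : {fset G}).

Definition all_shapes : {fset {fset G}} := (\bigcup_(F <- Fs) shapes d F)%fset.

Lemma all_shapesP A : A \in all_shapes -> exists2 F, F \in Fs & A \in shapes d F.
Proof. by move=> /bigfcupP[F]; rewrite andbT => ? ?; exists F. Qed.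

Definition untyped (t : G -> tiles all_shapes) : G -> {fset G} := fun g => val (t g).

Definition valid_shift : set (G -> tiles all_shapes) :=
  [set t | valid d Fs (untyped t)].

Lemma untyped_lift s : valid d Fs s -> exists t, untyped t = s.
Proof.
move=> vs; have inT g : s g \in tiles all_shapes.
  have [->|[F FFs sF]] := valid_tile g vs; rewrite !inE ?eqxx//.
  by apply/orP; right; apply/bigfcupP; exists F; rewrite ?FFs.
by exists (fun g => [` inT g]%fset); apply/funext => g.
Qed.

Lemma valid_shift_is_shift : levels_separated d Fs -> is_shift valid_shift.
Proof.
move=> lsep; split.
- have [s vs] := valid_exists lsep; have [t ts] := untyped_lift vs.
  by exists t; rewrite /valid_shift /= ts.
- apply: closed_local => t loc; apply: (@valid_closed _ _ (\bigcup_(F <- Fs) F)%fset).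
    by move=> F FFs; apply/bigfcup_sup.
  move=> W; have [s vs st] := loc W; exists (untyped s) => // g gW.
  by rewrite /untyped st.
- by move=> g t vt; exact: (valid_translation g vt).
Qed.

Lemma valid_shift_quasi_tilings : valid_shift `<=` quasi_tilings all_shapes.
Proof.
move=> t /valid_disjoint tdis g h gh; apply/fsetP => u; rewrite !inE.
apply/negbTE/negP => /andP[/imfsetP[a /= at_ ->] /imfsetP[b /= bt e]].
move/eqP: gh; apply; apply: (tdis g h (g * a)%g); first by rewrite mulKg.
by rewrite e mulKg.
Qed.

Lemma errors_uncovered t K : errors t K = uncovered (untyped t) K.
Proof.
apply/fsetP => g; rewrite !inE /=; congr (_ && ~~ _); apply: asbool_equiv_eq; split.
  by move=> [h /imfsetP[a /= ah ->]]; exists h; rewrite mulKg.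
by move=> [h hg]; exists h; apply/imfsetP; exists (h^-1 * g)%g; rewrite ?mulVKg.
Qed.

Lemma valid_shift_irreducible : levels_separated d Fs ->
  strongly_irreducible S valid_shift.
Proof.
move=> lsep; pose E := (1%g |` \bigcup_(F <- Fs) F)%fset.
have E1 : 1%g \in E by rewrite !inE eqxx.
have FE F : F \in Fs -> (F `<=` E)%fset.
  by move=> FFs; apply: fsubset_trans (fsubsetU1 _ _); apply/bigfcup_sup.
pose l := (\max_(a <- E) word_length S a)%N.
have El a : a \in E -> (word_length S a <= l)%N.
  by move=> aE; rewrite /l (@leq_bigmax_seq _ _ _ (word_length S)).
(* The [n]-fold neighborhood reaches distance at most [n (l + l)]; twice this distance keeps those
   of [K] and [H] disjoint. *)
pose n := (size Fs).*2; exists (n * (l + l) + n * (l + l))%N => K H far x y vx vy.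
have sep g : iter n (neighborhood E) [set` K] g -> ~ iter n (neighborhood E) [set` H] g.
  move=> /(iter_neighborhood_dist El)[k kK kg] /(iter_neighborhood_dist El)[h hH hg].
  have := far k h kK hH; rewrite ltnNge => /negP; apply.
  rewrite (leq_trans (word_dist_triangle S k g h))// leq_add//.
  by rewrite word_dist_sym.
have [s [vs sx sy]] := valid_glue E1 FE lsep sep vx vy.
have [t ts] := untyped_lift vs.
exists t; split; first by rewrite /valid_shift /= ts.
  apply/ffunP => k; rewrite !ffunE; apply: val_inj.
  by rewrite -[LHS]/(untyped t (val k)) ts sx//; exact: valP.
apply/ffunP => k; rewrite !ffunE; apply: val_inj.
by rewrite -[LHS]/(untyped t (val k)) ts sy//; exact: valP.
Qed.

End ValidShift.

(** * Choice of constants and conclusion *)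

Lemma bernoulli_le (R : realType) (d : R) n : 0 <= d -> 1 + n%:R * d <= (1 + d) ^+ n.
Proof.
move=> d0; elim: n => [|n IH]; first by rewrite mul0r addr0 expr0.
rewrite exprS -natr1; apply: le_trans (ler_wpM2l _ IH); last by lra.
have : 0 <= n%:R * d * d by rewrite !mulr_ge0.
lra.
Qed.

Lemma nat_ge (R : realType) (x : R) : exists n : nat, x <= n%:R.
Proof.
exists (Num.bound `|x|); apply: le_trans (ler_norm x) _.
by apply/ltW/archi_boundP; exact: normr_ge0.
Qed.

Theorem theorem1p18 (R : realType) (G : groupType) (S : genset G)
    (G_infinite : infinite_set [set: G]) (G_countable : countable [set: G])
    (G_amenable : amenable R S) (r : nat) (eps : R) (eps_gt0 : 0 < eps) :
  exists (T : {fset {fset G}}) (Q : set (G -> tiles T)),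
    [/\ tile_set T, tile_set_invariant S r eps T,
        is_shift Q & Q `<=` quasi_tilings T] /\
    [/\ error_density_le S Q eps,
        (exists2 h : R, has_entropy S Q h & h < eps) &
        strongly_irreducible S Q].
Proof.
(* The entropy will be at most [2 gam + sig], with both terms at most $\varepsilon/4$. *)
pose gam : R := Num.min 1 (eps / 8).
have gam0 : 0 < gam by rewrite lt_min ltr01 divr_gt0.
have gam1 : gam <= 1 by rewrite ge_min lexx.
have gam_eps : gam <= eps / 8 by rewrite ge_min lexx orbT.
pose B := fset_set (Defs.ball S r); pose b2 : R := #|` B|%:R ^+ 2.
have b20 : 0 <= b2 by rewrite exprn_ge0.
(* The first entry serves [shapes_weight]; the second brings the constant $4d|B|^2$ of
   [tile_invariant] below $\varepsilon$. *)
pose d : R := Num.min (gam ^+ 2 / 64) (eps / (4 * (b2 + 1))).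
have d0 : 0 < d by rewrite lt_min !divr_gt0 ?exprn_gt0// mulr_gt0// ltr_wpDl.
have dgam : 64 * d <= gam ^+ 2.
  have : d <= gam ^+ 2 / 64 by rewrite ge_min lexx.
  lra.
have d12 : d <= 1 / 2.
  have : gam ^+ 2 <= 1 by rewrite expr_le1// ltW.
  lra.
have db : 4 * d * b2 <= eps.
  have : d <= eps / (4 * (b2 + 1)) by rewrite ge_min lexx orbT.
  by rewrite ler_pdivlMr ?mulr_gt0 ?ltr_wpDl//; nra.
(* By Bernoulli's inequality, $N$ levels give $\varepsilon(1+d)^N \ge 2$. *)
have [N Nd] := nat_ge (2 / (eps * d)).
have dN : 2 <= eps * (1 + d) ^+ N.
  move: Nd; rewrite ler_pdivrMr ?mulr_gt0// => Nd.
  apply: le_trans (ler_wpM2l (ltW eps_gt0) (bernoulli_le N (ltW d0))).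
  by rewrite mulrDr; lra.
(* Tiles so large that $y = \gamma m/4$ satisfies $\varepsilon y \ge 4N$, hence $Ne^{-y} <
   \varepsilon/4$. *)
have [m me] := nat_ge (16 * N%:R / (gam * eps)).
(* Makes the additive loss $5\eta|K|/d$ equal to $\varepsilon|K|/2$. *)
pose eta := eps * d / 10.
have eta0 : 0 < eta by rewrite divr_gt0 ?mulr_gt0.
pose P := [fset (b^-1 * b')%g | b in B, b' in B]%fset.
have [Fs [szFs lev Fsm _]] := levels_exist m P N [::] G_infinite G_amenable d0 d12 eta0.
have lsep := levels_stable_separated lev.
exists (all_shapes d Fs), (@valid_shift R G d Fs).
have finB : finite_set (Defs.ball S r) by exact: finite_ball.
have Qsh := valid_shift_is_shift lsep.
pose E := (\bigcup_(F <- Fs) F)%fset.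
have FE F : F \in Fs -> (F `<=` E)%fset by move=> FFs; apply/bigfcup_sup.
split; split => //.
- by move=> A /all_shapesP[F _ /shapesP[]].
- move=> A /all_shapesP[F FFs AF].
  have [_ _ Fst] := Fsm F FFs.
  have [|A0 rhoA] := tile_invariant (S := S) (r := r) d12 _ AF.
  + move=> b b' bB b'B; apply: Fst; apply/imfset2P.
    by exists b; [rewrite /= in_fset_set ?inE|exists b' => //=; rewrite in_fset_set ?inE].
  by split => //; exact: le_trans db.
- exact: valid_shift_quasi_tilings.
- pose PE := products E.
  (* The second entry ensures $|KEE^{-1}E| \le 2|K|$. *)
  pose eta' := Num.min eta (#|` PE|%:R + 1)^-1.
  have p0 : (0 : R) < #|` PE|%:R + 1 by rewrite ltr_wpDl.
  have eta'0 : 0 < eta' by rewrite lt_min eta0 invr_gt0.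
  have [delta delta0 st] := @invariant_stable R G S PE eta' eta'0.
  exists delta => // t K vt /st Kst.
  rewrite errors_uncovered.
  have Kst' : stable PE eta K.
    by move=> c /Kst /le_trans; apply; rewrite ler_wpM2r// ge_min lexx.
  have KP : #|` thicken K PE|%:R <= 2 * #|` K|%:R :> R.
    apply: (le_trans (card_thicken Kst)); rewrite ler_wpM2r//.
    have : eta' <= (#|` PE|%:R + 1)^-1 by rewrite ge_min lexx orbT.
    move=> /(ler_wpM2l (ler0n R #|` PE|)) /le_trans H.
    suff : #|` PE|%:R * eta' <= 1 by lra.
    by apply: H; rewrite ler_pdivrMr// mul1r lerDl.
  have := uncovered_bound d0 d12 (ltW eta0) FE lev Kst' KP vt.
  rewrite szFs; have -> : 5 * eta * #|` K|%:R / d = eps / 2 * #|` K|%:R.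
    by rewrite /eta; field; rewrite gt_eqF.
  set u : R := #|` uncovered _ _|%:R; set k : R := #|` K|%:R => le_k.
  (* If $u > \varepsilon k$, then $u$ exceeds the loss $\varepsilon k/2$ by more than $\varepsilon
     k/2$, and multiplying by $(1+d)^N$ gives more than $k$. *)
  rewrite leNgt; apply/negP => lt_u.
  have k0 : 0 <= k by [].
  have : 0 < u - eps * k by rewrite subr_gt0.
  have q0 : 0 < (1 + d) ^+ N by rewrite exprn_gt0//; lra.
  move=> /(mulr_gt0 q0); have := ler_wpM2r k0 dN.
  move: le_k; lra.
- have [h hent hle] := shift_entropy (R := R) S Qsh.
  exists h => //.
  have e0 : 0 < (#|` E|%:R + 1)^-1 :> R by rewrite invr_gt0 ltr_wpDl.
  (* One stable [K] is enough, since [h] is at most the ratio at every nonempty finite set. *)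
  have [K [K1 _ Kst]] := stable_exists E 0 G_infinite G_amenable e0.
  have K0 : K != fset0 by apply/fset0Pn; exists 1%g.
  have k0 : (0 : R) < #|` K|%:R by rewrite ltr0n cardfs_gt0.
  have KE : #|` thicken K E|%:R <= 2 * #|` K|%:R :> R.
    apply: (le_trans (card_thicken Kst)); rewrite ler_wpM2r//.
    suff : #|` E|%:R * (#|` E|%:R + 1)^-1 <= 1 :> R by lra.
    by rewrite ler_pdivrMr ?ltr_wpDl// mul1r lerDl.
  have := nwords_tiles (X := @valid_shift R G d Fs) (ltW gam0) (fun t vt => valid_disjoint vt) _ KE.
  have AE A : A \in all_shapes d Fs -> (A `<=` E)%fset.
    by move=> /all_shapesP[F /FE FFs /shapesP[AF _ _]]; exact: fsubset_trans FFs.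
  move=> /(_ AE); set sig := \sum_(A <- _) _ => wK.
  have Q0 : (0 : R) < (nwords (@valid_shift R G d Fs) K)%:R.
    by rewrite ltr0n; apply: nwords_gt0; case: Qsh.
  have hK : h <= 2 * gam + sig.
    apply: (le_trans (hle K K0)); rewrite ler_pdivrMr//.
    by rewrite -ler_expR lnK.
  have mFs F : F \in Fs -> (m <= #|` F|)%N by move=> /Fsm[_ /ltnW].
  have := shapes_weight (ltW d0) d12 gam0 gam1 dgam (@all_shapesP R G d Fs) mFs.
  rewrite -/sig szFs => sigN.
  set y := gam / 4 * m%:R in sigN.
  have yN : 4 * N%:R <= eps * y.
    move: me; rewrite ler_pdivrMr ?mulr_gt0// /y; lra.
  have y0 : 0 <= y by rewrite mulr_ge0// ltW// divr_gt0.
  have : N%:R * expR (- y) < eps / 4 :> R.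
    rewrite expRN ltr_pdivrMr ?expR_gt0//.
    have := ler_wpM2l (ltW eps_gt0) (expR_ge1Dx y); lra.
  lra.
- exact: valid_shift_irreducible.
Qed.
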